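(* Let $n\in\{2,3\}$, $k>0$, and let $\mathcal{K}_k$ be the $2R$-periodic truncated kernel with Fourier coefficients $\widehat{\mathcal{K}}_k(j)$, $j\in\mathbb{Z}^n$, as defined in the context. Then the Fourier coefficients of $\mathcal{K}_k$ are given, for all $j\in\mathbb{Z}^n$, as follows. For $n=2$, $$\widehat{\mathcal{K}}_k(j) = \begin{cases} \frac{\pi R}{8} \left[J_0^2(kR)+J_1^2(kR)\right], & \pi |j|= kR, \\ -\frac{1}{4}\cdot\frac{\pi R}{k^2R^2-\pi^2|j|^2}\left[\pi|j|J_0(kR)J_1(\pi|j|)-kR J_1(kR)J_0(\pi|j|)\right], & \pi |j|\neq kR. \end{cases}$$ For $n=3$, $$\widehat{\mathcal{K}}_k(j) = \begin{cases} (2R)^{-3/2}\frac{ R^2}{2}\left\{ kR \left[j_0^2(kR)+j_1^2(kR)\right]-j_0(kR)j_1(kR)\right\}, & \pi |j|= kR, \\ kR(2R)^{-3/2}\frac{R^2}{k^2R^2-\pi^2|j|^2}\left[kR\,j_0(\pi |j|)j_1(kR)-\pi|j|\,j_0(kR)j_1(\pi|j|)\right], & \pi |j|\neq kR,\ |j|\neq 0,\\ \frac{1}{k}(2R)^{-3/2}\left(\frac{1}{k}\sin(kR)-R\cos(kR) \right), & |j|=0. \end{cases}$$ Moreover, as $|j|\to\infty$, $$\widehat{\mathcal{K}}_k(j) = \begin{cases} \mathcal{O}\left(|j|^{-3/2}\right), & n=2,\\ \mathcal{O}\left(|j|^{-2}\right), & n=3. \end{cases}$$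
   Context: Let $\rho>0$ be the radius of a ball $B_\rho$ centered at the origin whose closure contains the support of the source $f$, and let $R\ge 2\rho$ be fixed. Let $B_R$ be the ball of radius $R$ centered at the origin and $G_R=\{x\in\mathbb{R}^n: |x_\ell|<R,\ \ell=1,\dots,n\}$. Set $$\operatorname{Im}\Phi_k(x)=\begin{cases}\frac14 J_0(k|x|), & n=2,\\ \frac{k}{4\pi}\,j_0(k|x|), & n=3.\end{cases}$$ The kernel $\mathcal{K}_k$ is defined on $G_R$ by $\mathcal{K}_k(x)=\operatorname{Im}\Phi_k(x)$ for $x\in B_R$ and $\mathcal{K}_k(x)=0$ for $x\in G_R\setminus\overline{B_R}$, and is extended to $\mathbb{R}^n$ as a function $2R$-periodic in each variable. For $j\in\mathbb{Z}^n$, $|j|=\sqrt{j_1^2+\dots+j_n^2}$ and $\varphi_j(x)=(2R)^{-n/2}e^{i\pi j\cdot x/R}$; these form an orthonormal basis of $L^2(G_R)$. The Fourier coefficients of $g\in L^2(G_R)$ are $\widehat g(j)=\int_{G_R} g(x)\,\overline{\varphi_j(x)}\,dx$. $J_0,J_1$ are Bessel functions of the first kind. The spherical Bessel functions are $j_0(x)=\frac{\sin x}{x}$ and $j_1(x)=\frac{\sin x}{x^2}-\frac{\cos x}{x}$ (extended continuously to $x=0$); these functions are distinguished from the multi-index $j$ and its components by being applied to an argument. *)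

(* Defs.v *)
From HB Require Import structures.
From mathcomp Require Import all_boot all_order all_algebra.
From mathcomp Require Import all_classical all_reals all_analysis.
From mathcomp Require Import complex.

Set Implicit Arguments.
Unset Strict Implicit.
Unset Printing Implicit Defensive.

Import Order.TTheory GRing.Theory Num.Theory.
Import numFieldNormedType.Exports.

Local Open Scope classical_set_scope.
Local Open Scope ring_scope.
Local Open Scope complex_scope.

Notation Rn R n := (n.-tuple (measurableTypeR R)).

Section lebesgue_cons.
Context (R : realType) (n : nat).
Variable m : {sigma_finite_measure set (Rn R n) -> \bar R}.
Local Open Scope ereal_scope.

Let consp (p : measurableTypeR R * Rn R n) : Rn R n.+1 :=
  [tuple of p.1 :: p.2].

Let splitp (x : Rn R n.+1) : measurableTypeR R * Rn R n :=
  (thead x, [tuple of behead x]).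

(* The image of [lebesgue_measure \x m] under the identification of [R * R^n]
   with [R^n.+1]. *)
Definition lebesgue_cons : set (Rn R n.+1) -> \bar R :=
  pushforward (@lebesgue_measure R \x m) consp.

Let mconsp : measurable_fun [set: measurableTypeR R * Rn R n] consp.
Proof. exact: measurable_cons. Qed.

Let msplitp : measurable_fun [set: Rn R n.+1] splitp.
Proof.
by apply: measurable_fun_pair;
  [exact: measurable_tnth | exact: measurable_behead].
Qed.

Let conspK : cancel consp splitp.
Proof. by case=> x t; congr pair; apply/val_inj. Qed.

Let lebesgue_cons0 : lebesgue_cons set0 = 0.
Proof. by rewrite /lebesgue_cons /pushforward preimage_set0 measure0. Qed.

Let lebesgue_cons_ge0 A : 0 <= lebesgue_cons A.
Proof. exact: measure_ge0. Qed.

Let lebesgue_cons_sigma_additive : semi_sigma_additive lebesgue_cons.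
Proof.
move=> F mF tF mUF; rewrite /lebesgue_cons /pushforward preimage_bigcup.
apply: measure_semi_sigma_additive.
- by move=> i; rewrite -[X in measurable X]setTI; exact: mconsp.
- apply/trivIsetP => /= i j _ _ ij; rewrite -preimage_setI.
  by move/trivIsetP : tF => /(_ _ _ _ _ ij) ->//; rewrite preimage_set0.
- by rewrite -preimage_bigcup -[X in measurable X]setTI; exact: mconsp.
Qed.

HB.instance Definition _ := isMeasure.Build _ _ _ lebesgue_cons
  lebesgue_cons0 lebesgue_cons_ge0 lebesgue_cons_sigma_additive.

Let lebesgue_cons_sigma_finite : sigma_finite setT lebesgue_cons.
Proof.
have /sigma_finiteP[F [TF ndF Foo]] := sigma_finiteT (@lebesgue_measure R).
have /sigma_finiteP[G [TG ndG Goo]] := sigma_finiteT m.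
exists (fun i => splitp @^-1` (F i `*` G i)).
  apply/esym/seteqP; split=> // x _.
  have [i _ Fi] : (\bigcup_i F i) (splitp x).1 by rewrite -TF.
  have [k _ Gk] : (\bigcup_i G i) (splitp x).2 by rewrite -TG.
  exists (maxn i k) => //; split.
    by move: Fi; exact/subsetPset/ndF/leq_maxl.
  by move: Gk; exact/subsetPset/ndG/leq_maxr.
move=> i; have [mF Fi] := Foo i; have [mG Gi] := Goo i; split.
  by rewrite -[X in measurable X]setTI; apply: msplitp => //; exact: measurableX.
rewrite /lebesgue_cons /pushforward (_ : _ @^-1` _ = F i `*` G i).
  by rewrite product_measure1E// lte_mul_pinfty// ge0_fin_numE.
rewrite -comp_preimage (_ : splitp \o consp = id)//.
by apply/funext => p; exact: conspK.
Qed.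

HB.instance Definition _ := Measure_isSigmaFinite.Build _ _ _ lebesgue_cons
  lebesgue_cons_sigma_finite.

End lebesgue_cons.

Fixpoint lebesgue_Rn (R : realType) (n : nat) :
    {sigma_finite_measure set (Rn R n) -> \bar R} :=
  if n is n'.+1 then lebesgue_cons (lebesgue_Rn R n')
  else \d_([tuple] : Rn R 0).

Section euclidean.
Context (R : realType) (n : nat).

Definition enorm (x : n.-tuple R) : R := Num.sqrt (\sum_(l < n) (tnth x l) ^+ 2).

Definition znorm (j : n.-tuple int) : R :=
  Num.sqrt (\sum_(l < n) (tnth j l)%:~R ^+ 2).

Definition zdot (j : n.-tuple int) (x : n.-tuple R) : R :=
  \sum_(l < n) (tnth j l)%:~R * tnth x l.

(* The filter of neighborhoods of infinity in Z^n, i.e. |j| -> oo. *)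
Definition znorm_pinfty : set_system (n.-tuple int) :=
  filter_from [set: R] (fun M => [set j | M < znorm j]).

Lemma znorm_pinfty_filter : Filter znorm_pinfty.
Proof.
apply: filter_from_filter; first by exists 0.
move=> M N _ _; exists (Num.max M N) => // j /=.
by rewrite gt_max => /andP[].
Qed.

Canonical znorm_pinfty_filter_on := FilterType znorm_pinfty znorm_pinfty_filter.

End euclidean.
Arguments znorm R {n} j.
Arguments znorm_pinfty R n : clear implicits.

Section special_functions.
Context (R : realType).

(* Bessel function of the first kind of integer order [m]. *)
Definition besselJ (m : nat) (x : R) : R :=
  limn (series (fun i : nat =>
    (-1) ^+ i / (i`! * (i + m)`!)%N%:R * (x / 2) ^+ (i.*2 + m)%N)).

(* Spherical Bessel functions, extended by continuity at 0. *)
Definition sphj0 (x : R) : R := if x == 0 then 1 else sin x / x.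

Definition sphj1 (x : R) : R :=
  if x == 0 then 0 else sin x / x ^+ 2 - cos x / x.

End special_functions.

Section kernel.
Context (R : realType) (n : nat).

(* Imaginary part of the outgoing fundamental solution of the Helmholtz
   equation; only meaningful in dimensions 2 and 3. *)
Definition im_Phi (k : R) (x : n.-tuple R) : R :=
  match n with
  | 2%N => 4^-1 * besselJ 0 (k * enorm x)
  | 3%N => k / (4 * pi) * sphj0 (k * enorm x)
  | _ => 0
  end.

Definition cube (r : R) : set (n.-tuple R) :=
  [set x | forall l, `|tnth x l| < r].

Definition shift_period (r : R) (x : n.-tuple R) (l : 'I_n) : n.-tuple R :=
  [tuple tnth x i + (if i == l then 2 * r else 0) | i < n].

(* The representative [u] of [t] modulo [2 * r] such that [- r <= u < r]. *)
Definition reduce (r t : R) : R :=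
  t - 2 * r * (Num.floor ((t + r) / (2 * r)))%:~R.

(* Zero on the sphere |x| = r and its translates, a null set where the value is
   immaterial.  See [truncated_kernel_periodic] and [truncated_kernel_cube]. *)
Definition truncated_kernel (k r : R) (x : n.-tuple R) : R :=
  let y := [tuple reduce r (tnth x l) | l < n] in
  if enorm y < r then im_Phi k y else 0.

Lemma reduce_periodic (r t : R) : 0 < r -> reduce r (t + 2 * r) = reduce r t.
Proof.
move=> r0; rewrite /reduce.
have r20 : 2 * r != 0 by rewrite mulf_neq0// gt_eqF.
rewrite (_ : (t + 2 * r + r) / (2 * r) = (t + r) / (2 * r) + 1); last first.
  by rewrite addrAC mulrDl divff.
rewrite floorDrz ?int_num1// floor1 rmorphD/= mulrDr mulr1.
by rewrite opprD addrACA addrN addr0.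
Qed.

Lemma reduce_id (r t : R) : `|t| < r -> reduce r t = t.
Proof.
rewrite ltr_norml => /andP[Nrt tr].
have r0 : 0 < 2 * r.
  by rewrite mulr_gt0// -(@pmulrn_lgt0 _ r 2)// mulr2n -ltrBlDr sub0r (lt_trans Nrt).
rewrite /reduce (_ : Num.floor _ = 0) ?mulr0 ?subr0//.
apply/floor_def; rewrite ler_pdivlMr// ltr_pdivrMr// mul0r add0r mul1r.
by rewrite -lerBlDr sub0r ltW//= mulr2n mulrDl mul1r ltrD2r.
Qed.

Lemma truncated_kernel_periodic (k r : R) (x : n.-tuple R) (l : 'I_n) :
  0 < r -> truncated_kernel k r (shift_period r x l) = truncated_kernel k r x.
Proof.
move=> r0; rewrite /truncated_kernel.
rewrite (_ : [tuple _ | _ < n] = [tuple reduce r (tnth x i) | i < n])//.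
apply: eq_from_tnth => i; rewrite !tnth_mktuple.
by case: eqP => _; rewrite ?addr0// reduce_periodic.
Qed.

Lemma truncated_kernel_cube (k r : R) (x : n.-tuple R) : cube r x ->
  truncated_kernel k r x = if enorm x < r then im_Phi k x else 0.
Proof.
move=> xr; rewrite /truncated_kernel.
rewrite (_ : [tuple _ | _ < n] = x)//.
by apply: eq_from_tnth => i; rewrite tnth_mktuple reduce_id.
Qed.

End kernel.

Section fourier.
Context (R : realType) (n : nat).

Definition cexpi (t : R) : R[i] := cos t +i* sin t.

Definition cintegral (D : set (Rn R n)) (g : Rn R n -> R[i]) : R[i] :=
  Rintegral (lebesgue_Rn R n) D (fun x => complex.Re (g x)) +i*
  Rintegral (lebesgue_Rn R n) D (fun x => complex.Im (g x)).

Definition phi (r : R) (j : n.-tuple int) (x : n.-tuple R) : R[i] :=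
  ((2 * r) `^ (- n%:R / 2))%:C * cexpi (pi * zdot j x / r).

Definition fourier_coef (r : R) (g : n.-tuple R -> R[i]) (j : n.-tuple int) :
    R[i] :=
  cintegral (cube r) (fun x => g x * (phi r j x)^*%C).

End fourier.

(* Main.v *)
Require Import Defs.
From HB Require Import structures.
From mathcomp Require Import all_boot all_order all_algebra.
From mathcomp Require Import all_classical all_reals all_analysis.
From mathcomp Require Import complex.
From mathcomp Require Import measurable_realfun ring lra.

Set Implicit Arguments.
Unset Strict Implicit.
Unset Printing Implicit Defensive.

Import Order.TTheory GRing.Theory Num.Theory.
Import numFieldNormedType.Exports.

Local Open Scope classical_set_scope.
Local Open Scope ring_scope.
Local Open Scope complex_scope.

(** Write xi = pi j / r. On the cube the kernel is a radial function h(|x|^2) cut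
    off at |x| = r, so the coefficient is, up to a constant, the integral over
    the ball of radius r of h(|x|^2) exp(- i xi . x); its imaginary part vanishes
    by oddness. What is needed is a substitute for polar coordinates, and the
    invariance of the Lebesgue measure under rotations.

    A rotation in a coordinate plane is a product of three shears, and a shear
    moves one coordinate by an amount that depends on the others, hence preserves
    the measure by Tonelli's theorem and translation invariance on the line
    ([lebesgue_preserving_rot]). The area pi s of the disk |x|^2 < s then
    identifies the image of the planar measure under |x|^2 as pi times the
    Lebesgue measure of the half line ([integral_sqnorm]).

    In the plane, average cos (xi . x) over all rotations of x: by Poisson's
    integral ([integral_cos_circle]) the mean is J_0(|xi| |x|), so the coefficient
    is an integral over [0, r^2] of a product J_0(k sqrt t) J_0(|xi| sqrt t)
    ([integral_disk_cos]). Lommel's primitives of such products give both closed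
    forms ([integral_besselC_neq], [integral_besselC_eq]).

    In space, rotate xi onto the first axis and slice the ball by planes
    orthogonal to it. On each slice the radial formula applies, and
    sin (k sqrt u) / (k sqrt u) has the explicit primitive
    - 2 cos (k sqrt u) / k^2; what remains is the integral over [- r, r] of
    cos (|xi| t) (cos (k t) - cos (k r)), which is elementary
    ([integral_ball_sphj0]).

    The decay follows from the closed forms: the denominator grows like |j|^2,
    and the numerator is bounded in space while in the plane it is
    O(|j|^(1/2)), since J_0 and J_1 are O(x^(-1/2)) by monotonicity of an energy
    ([besselJ_decay]). *)

(** * Coordinatewise maps and the Lebesgue measure *)

Section lebesgue_preserving.
Context (R : realType).
Notation leb := (@lebesgue_measure R).
Local Open Scope ereal_scope.

(** Such a map sends intervals to intervals of the same length, and intervals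
    determine the measure. *)
Lemma lebesgue_measure_affine (e t : R) (A : set (measurableTypeR R)) :
  (e = 1 \/ e = -1)%R -> measurable A ->
  leb ((fun v : R => e * v + t)%R @^-1` A) = leb A.
Proof.
move=> e1 mA.
have mf : measurable_fun setT ((fun v =>
  e * v + t)%R : measurableTypeR R -> measurableTypeR R).
  by apply: measurable_funD => //; apply: measurable_funM.
pose F := isMeasurableFun.Build _ _ _ _ _ mf.
pose g : {mfun measurableTypeR R >-> measurableTypeR R} := HB.pack (fun v : R =>
  e * v + t)%R F.
apply/esym; rewrite (@lebesgue_measure_unique _ (pushforward leb g))// =>
  X [[a b] /= _ <-{X}].
rewrite /pushforward/=.
case: e1 => e1.
  rewrite (_ : _ @^-1` _ = `](a - t)%R, (b - t)%R]%classic); last first.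
    apply/seteqP; split => v /=; rewrite !in_itv/= e1; lra.
  rewrite !lebesgue_measure_itv/= !lte_fin ltrD2r.
  by case: ifPn => // _; congr EFin; lra.
rewrite (_ : _ @^-1` _ = `[(t - b)%R, (t - a)%R[%classic); last first.
  by apply/seteqP; split => v /=; rewrite !in_itv/= e1; lra.
rewrite !lebesgue_measure_itv/= !lte_fin ltrD2l ltrN2.
by case: ifPn => // _; congr EFin; lra.
Qed.

Notation mu n := (lebesgue_Rn R n).

Definition consp n (p : measurableTypeR R * Rn R n) : Rn R n.+1 :=
  [tuple of p.1 :: p.2].

Lemma measurable_consp n : measurable_fun [set: measurableTypeR R * Rn R n] (@consp n).
Proof. exact: measurable_cons. Qed.

Lemma lebesgue_RnS n (A : set (Rn R n.+1)) :
  mu n.+1 A = (leb \x mu n) (@consp n @^-1` A).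
Proof. by []. Qed.

Lemma measurable_preimage d d' (T : measurableType d) (U : measurableType d')
    (f : T -> U) (A : set U) :
  measurable_fun setT f -> measurable A -> measurable (f @^-1` A).
Proof. by move=> mf mA; rewrite -[X in measurable X]setTI; exact: mf. Qed.

(** Both orders of integration are used below: a change of one coordinate acts
    either on the first coordinate, the others being fixed, or on the others. *)
Lemma lebesgue_RnS1 n (A : set (Rn R n.+1)) : measurable A ->
  mu n.+1 A = \int[leb]_t (mu n [set w | A (consp (t, w))]).
Proof.
move=> mA; rewrite lebesgue_RnS.
apply: eq_integral => t _; congr (mu n _).
by apply/seteqP; split => w /=; rewrite /xsection/= inE.
Qed.

Lemma lebesgue_RnS2 n (A : set (Rn R n.+1)) : measurable A ->
  mu n.+1 A = \int[mu n]_w (leb [set t | A (consp (t, w))]).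
Proof.
move=> mA; rewrite lebesgue_RnS.
have mB : measurable (@consp n @^-1` A).
  exact: measurable_preimage (@measurable_consp n) mA.
rewrite (@product_measure_unique _ _ _ _ _ _ _ (leb \x^ mu n))//; last first.
  by move=> X Y mX mY; exact: product_measure2E.
apply: eq_integral => t _; congr (leb _).
by apply/seteqP; split => w /=; rewrite /ysection/= inE.
Qed.

Definition set_coord n (l : 'I_n) (x : Rn R n) (v : R) : Rn R n :=
  [tuple if i == l then v else tnth x i | i < n].

Definition lebesgue_preserving n (T : Rn R n -> Rn R n) := measurable_fun setT T /\
  forall A, measurable A -> mu n (T @^-1` A) = mu n A.

Lemma measurable_set_coord n d (U : measurableType d) (l : 'I_n) (f : U -> Rn R n)
    (h : U -> measurableTypeR R) : measurable_fun setT f -> measurable_fun setT h ->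
  measurable_fun setT (fun x => set_coord l (f x) (h x)).
Proof.
move=> mf mh; apply/measurable_fun_tnthP => i.
have [il|il] := eqVneq i l.
  by rewrite (_ : _ \o _ = h)//; apply/funext => x /=; rewrite tnth_mktuple il eqxx.
rewrite (_ : _ \o _ = (fun x => tnth (f x) i)).
  by move/measurable_fun_tnthP : mf; exact.
by apply/funext => x /=; rewrite tnth_mktuple (negbTE il).
Qed.

Lemma set_coord0 n (t v : R) (w : Rn R n) :
  set_coord ord0 (consp (t, w)) v = consp (v, w).
Proof.
apply: eq_from_tnth => i; rewrite tnth_mktuple.
by case: (unliftP ord0 i) => [j ->|->]; rewrite ?tnthS//.
Qed.

Lemma set_coordS n (l : 'I_n) (t v : R) (w : Rn R n) :
  set_coord (lift ord0 l) (consp (t, w)) v = consp (t, set_coord l w v).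
Proof.
apply: eq_from_tnth => i; rewrite tnth_mktuple.
by case: (unliftP ord0 i) => [j ->|->]; rewrite ?tnthS ?tnth_mktuple.
Qed.

(** Cavalieri's principle: it is enough that the new coordinate depends on the
    old one, the others being frozen, through a map that preserves lengths. The
    induction peels off first coordinates until the moved one comes first. *)
Lemma lebesgue_preserving_set_coord n (l : 'I_n) (h : Rn R n -> measurableTypeR R) :
  measurable_fun setT h ->
  (forall x A, measurable A -> leb [set v | A (h (set_coord l x v))] = leb A) ->
  lebesgue_preserving (fun x => set_coord l x (h x)).
Proof.
move=> mh hA; split; first exact: measurable_set_coord.
elim: n l h mh hA => [[]//|n ih l h mh hA A mA].
have mT : measurable ((fun x => set_coord l x (h x)) @^-1` A).
  apply: measurable_preimage mA.
  exact: (measurable_set_coord l (@measurable_id _ _ setT) mh).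
case: (unliftP ord0 l) => [j lj|l0]; subst l.
  rewrite !lebesgue_RnS1//; apply: eq_integral => t _.
  have mct : measurable_fun setT (fun w : Rn R n => consp (t, w)).
    exact: (measurable_cons (measurable_cst (t : measurableTypeR R))
              (@measurable_id _ _ setT)).
  rewrite -[RHS](ih j (fun w => h (consp (t, w))))//.
  - by congr (mu n _); apply/seteqP; split => w /=; rewrite set_coordS.
  - exact: (measurableT_comp mh mct).
  - move=> x C mC; rewrite -[RHS](hA (consp (t, x)))//.
    by congr (leb _); apply/seteqP; split => w /=; rewrite set_coordS.
  - exact: measurable_preimage mct mA.
rewrite !lebesgue_RnS2//; apply: eq_integral => w _.
have mct : measurable_fun setT (fun t : measurableTypeR R => consp (t, w)).
  exact: (measurable_cons (@measurable_id _ _ setT) (measurable_cst w)).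
rewrite -[RHS](hA (consp (0%R, w))); last exact: measurable_preimage mct mA.
by congr (leb _); apply/seteqP; split => t /=; rewrite !set_coord0.
Qed.

Lemma lebesgue_preserving_comp n (S T : Rn R n -> Rn R n) :
  lebesgue_preserving S -> lebesgue_preserving T -> lebesgue_preserving (S \o T).
Proof.
move=> [mS hS] [mT hT]; split; first exact: measurableT_comp.
move=> A mA; rewrite comp_preimage hT ?hS//.
exact: measurable_preimage.
Qed.

Definition shear n (i j : 'I_n) (t : R) (x : Rn R n) : Rn R n :=
  set_coord i x (tnth x i + t * tnth x j)%R.

Lemma lebesgue_preserving_shear n (i j : 'I_n) t : i != j ->
  lebesgue_preserving (shear i j t).
Proof.
move=> ij; apply: lebesgue_preserving_set_coord.
  apply: (measurable_funD (measurable_tnth i)).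
  exact: (measurable_funM (measurable_cst (t : R)) (measurable_tnth j)).
move=> x A mA.
rewrite -(@lebesgue_measure_affine 1 (t * tnth x j) A)//; last by left.
congr (leb _); apply/seteqP; split => v /=;
  by rewrite !tnth_mktuple eqxx [j == i]eq_sym (negbTE ij) mul1r.
Qed.

Definition flip n (i : 'I_n) (x : Rn R n) : Rn R n := set_coord i x (- tnth x i)%R.

Lemma lebesgue_preserving_flip n (i : 'I_n) : lebesgue_preserving (flip i).
Proof.
apply: lebesgue_preserving_set_coord; first exact: (measurable_funN (measurable_tnth i)).
move=> x A mA.
rewrite -(@lebesgue_measure_affine (-1) 0 A)//; last by right.
congr (leb _); apply/seteqP; split => v /=;
  by rewrite !tnth_mktuple eqxx mulN1r addr0.
Qed.

End lebesgue_preserving.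

Section integral_transfer.
Local Open Scope ereal_scope.

(** Change of variables for the positive and the negative part separately. *)
Lemma integral_image d1 d2 (X : measurableType d1) (Y : measurableType d2)
    (R : realType) (mu : {measure set X -> \bar R}) (nu : {measure set Y -> \bar R})
    (phi : X -> Y) (f : Y -> \bar R) :
  measurable_fun setT phi ->
  (forall A, measurable A -> nu A = mu (phi @^-1` A)) ->
  measurable_fun setT f ->
  \int[nu]_y f y = \int[mu]_x f (phi x).
Proof.
move=> mphi nuE mf.
pose F := isMeasurableFun.Build _ _ _ _ _ mphi.
pose g : {mfun X >-> Y} := HB.pack phi F.
have H (h : Y -> \bar R) : measurable_fun setT h -> (forall y, 0 <= h y) ->
    \int[nu]_y h y = \int[mu]_x h (phi x).
  move=> mh h0; rewrite (eq_measure_integral (pushforward mu g)).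
    by rewrite (ge0_integral_pushforward mphi)// preimage_setT.
  by move=> A mA _; rewrite nuE.
rewrite [LHS]integralE [RHS]integralE; congr (_ - _).
  rewrite H//; last exact: measurable_funepos.
  by apply: eq_integral => x _; rewrite !funeposE.
rewrite H//; last exact: measurable_funeneg.
by apply: eq_integral => x _; rewrite !funenegE.
Qed.

Variable R : realType.
Notation leb := (@lebesgue_measure R).
Notation mu n := (lebesgue_Rn R n).

Lemma integral_lebesgue_preserving n (T : Rn R n -> Rn R n) (f : Rn R n -> \bar R) :
  lebesgue_preserving T -> measurable_fun setT f -> \int[mu n]_x f (T x) = \int[mu n]_x
    f x.
Proof.
move=> [mT hT] mf; apply/esym/integral_image => // A mA; exact/esym/hT.
Qed.

Lemma integral_consp n (f : Rn R n.+1 -> \bar R) : measurable_fun setT f ->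
  \int[mu n.+1]_x f x = \int[leb \x mu n]_p f (consp p).
Proof. by move=> mf; apply: integral_image => //; exact: measurable_consp. Qed.

Lemma fubini_consp n (f : Rn R n.+1 -> \bar R) :
  (mu n.+1).-integrable setT f ->
  \int[mu n.+1]_x f x = \int[leb]_t \int[mu n]_w f (consp (t, w)).
Proof.
move=> /integrableP[mf fi]; rewrite integral_consp//.
have mfc : measurable_fun setT (f \o @consp R n).
  exact: measurableT_comp mf (@measurable_consp R n).
rewrite -(integral12_prod_meas1 (f := f \o @consp R n))//.
apply/integrableP; split => //.
rewrite -(integral_consp (f := abse \o f))//.
exact: measurableT_comp.
Qed.

Definition rot n (i j : 'I_n) (c s : R) (x : Rn R n) : Rn R n :=
  [tuple if k == i then (c * tnth x i - s * tnth x j)%R else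
         if k == j then (s * tnth x i + c * tnth x j)%R else tnth x k | k < n].

(** Three shears make a rotation: with t = - s / (1 + c), the tangent of minus half
    the angle, x += t y, then y += s x, then x += t y. Only the half turn c = -1
    escapes, and it is a product of two reflections. *)
Lemma lebesgue_preserving_rot n (i j : 'I_n) c s : i != j -> (c ^+ 2 + s ^+ 2 = 1)%R ->
  lebesgue_preserving (rot i j c s).
Proof.
move=> ij cs1; have ji : (j == i) = false by rewrite eq_sym (negbTE ij).
have [cN1|cN1] := eqVneq c (-1)%R.
  have s0 : (s = 0)%R.
    by apply/eqP; rewrite -sqrf_eq0; apply/eqP; move: cs1; rewrite cN1; lra.
  rewrite (_ : rot i j c s = @flip R n i \o @flip R n j).
    by apply: lebesgue_preserving_comp; exact: lebesgue_preserving_flip.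
  apply/funext => x; apply: eq_from_tnth => k.
  rewrite cN1 s0 /= !tnth_mktuple ?eqxx ?(negbTE ij) ?ji.
  by do 2?case: ifPn => _ //; lra.
have c1 : (1 + c != 0)%R by rewrite addrC addr_eq0.
pose t := (- s / (1 + c))%R.
have st : (1 + s * t = c)%R.
  have s2 : (s ^+ 2 = (1 + c) * (1 - c))%R by move: cs1; lra.
  have -> : (1 + s * t = 1 - s ^+ 2 / (1 + c))%R by rewrite /t; field.
  by rewrite s2; field.
have tc : (t + t * c = - s)%R by rewrite /t; field.
rewrite (_ : rot i j c s = (shear i j t \o shear j i s) \o shear i j t).
  apply: lebesgue_preserving_comp; last exact: lebesgue_preserving_shear.
  by apply: lebesgue_preserving_comp; apply: lebesgue_preserving_shear; rewrite // ji.
apply/funext => x; apply: eq_from_tnth => k.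
rewrite /= !tnth_mktuple ?eqxx ?(negbTE ij) ?ji.
case: ifPn => [_|ki].
  have -> a b : (c * a - s * b = c * a + (- s) * b)%R by ring.
  by rewrite -tc -st; ring.
by case: ifPn => [_|//]; rewrite -st; ring.
Qed.

End integral_transfer.

(** * Integrals over segments *)

Section segments.
Context (R : realType).
Notation leb := (@lebesgue_measure R).

Lemma integral_is_derive (f F : R -> R) (a b : R) : a <= b -> continuous f ->
  (forall x, is_derive (x : R) (1 : R) F (f x)) ->
  (\int[leb]_(x in `[a, b]) (f x)%:E = (F b - F a)%:E)%E.
Proof.
rewrite le_eqVlt => /predU1P[-> _ _|ab cf dF].
  by rewrite set_itv1 integral_set1 subrr.
have cF : continuous F.
  by move=> x; apply/differentiable_continuous/derivable1_diffP; case: (dF x).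
rewrite EFinB; apply: continuous_FTC2 => //.
- exact: continuous_subspaceT.
- split; first by move=> x _; case: (dF x).
  + exact/cvg_at_right_filter/cF.
  + exact/cvg_at_left_filter/cF.
- by move=> x _; rewrite derive1E; case: (dF x).
Qed.

Lemma continuous_integrable_itv (f : R -> R) (a b : R) : continuous f ->
  leb.-integrable `[a, b] (EFin \o f).
Proof.
move=> cf; apply: continuous_compact_integrable; first exact: segment_compact.
exact: continuous_subspaceT.
Qed.

Lemma continuous_itv_bounded (h : R -> R) (a b : R) : continuous h ->
  exists M, forall t, a <= t <= b -> `|h t| <= M.
Proof.
move=> ch; have cptA : compact `[a, b]%classic by exact: segment_compact.
have ctsA : {within `[a, b], continuous h} by exact: continuous_subspaceT.
have /compact_bounded[M [_ mrt]] := continuous_compact ctsA cptA.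
exists (M + 1) => t tab; apply: mrt; first by rewrite ltrDl.
by exists t => //=; rewrite in_itv.
Qed.

Lemma is_derive_mull (c t : R) : is_derive t (1 : R) (fun t => c * t) c.
Proof.
have h : is_derive t (1 : R) (c \*: id) (c *: 1) by apply: is_deriveZ.
by apply: is_derive_eq h _; rewrite /GRing.scale/= mulr1.
Qed.

End segments.

(** * Radial functions in the plane *)

Section square_norm.
Context (R : realType).

Definition sqnorm n (x : Rn R n) : R := \sum_(l < n) tnth x l ^+ 2.

Lemma sqnorm_ge0 n (x : Rn R n) : 0 <= sqnorm x.
Proof. by apply: sumr_ge0 => i _; exact: sqr_ge0. Qed.

Lemma measurable_sqnorm n : measurable_fun setT (@sqnorm n).
Proof.
apply: measurable_sum => i; apply: measurable_funX; exact: measurable_tnth.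
Qed.

Lemma sqnorm2 (x : Rn R 2) :
  sqnorm x = tnth x ord0 ^+ 2 + tnth x (lift ord0 ord0) ^+ 2.
Proof. by rewrite /sqnorm !big_ord_recl big_ord0 addr0. Qed.

Lemma sqnorm_consp n t (w : Rn R n) : sqnorm (consp (t, w)) = t ^+ 2 + sqnorm w.
Proof.
rewrite /sqnorm big_ord_recl tnth0; congr (_ + _).
by apply: eq_bigr => i _; rewrite tnthS.
Qed.

End square_norm.

Section radial.
Context (R : realType).
Notation leb := (@lebesgue_measure R).
Notation mu n := (lebesgue_Rn R n).
Local Open Scope ereal_scope.

Lemma lebesgue_R1 (C : set (measurableTypeR R)) : measurable C ->
  mu 1 [set w | C (tnth w ord0)] = leb C.
Proof.
move=> mC; have mA : measurable [set w : Rn R 1 | C (tnth w ord0)].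
  exact: (measurable_preimage (@measurable_tnth _ _ _ ord0) mC).
rewrite lebesgue_RnS2//= (eq_integral (cst (leb C)))//.
have := @integral_cst _ _ _ (mu 0) setT measurableT (leb C) => ->.
rewrite -[RHS]mule1; congr (_ * _); exact: diracT.
Qed.

Lemma lebesgue_sqr_lt (u : R) : leb [set v : R | (v ^+ 2 < u)%R] = (2 * Num.sqrt u)%:E.
Proof.
rewrite (_ : [set v : R | _] = `](- Num.sqrt u)%R, (Num.sqrt u)[%classic).
  rewrite lebesgue_measure_itv/= lte_fin; case: ifPn => [_|].
    by congr EFin; ring.
  rewrite -leNgt => h; congr EFin.
  by have := sqrtr_ge0 u; lra.
apply/seteqP; split => v /=; rewrite in_itv/= -ltr_norml -sqrtr_sqr.
  move=> vu; rewrite ltr_sqrt//; apply: le_lt_trans vu; exact: sqr_ge0.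
by case: (ltP 0%R u) => [u0|u0]; [rewrite ltr_sqrt|
  rewrite (ler0_sqrtr u0) ltNge sqrtr_ge0].
Qed.

(** The chords of the disk of squared radius s; the substitution t = sqrt s sin x
    turns the integrand into 2 s cos^2 x. *)
Lemma integral_chords (s : R) : (0 < s)%R ->
  \int[leb]_t (2 * Num.sqrt (s - t ^+ 2))%:E = (pi * s)%:E.
Proof.
move=> s0; have ss0 : (0 < Num.sqrt s)%R by rewrite sqrtr_gt0.
have pi0 := @pi_gt0 R.
pose F (x : R) := (Num.sqrt s * sin x)%R.
have dF x : is_derive (x : R) (1 : R)%R F (Num.sqrt s * cos x)%R.
  by apply: is_deriveZ.
have F'E : (derive1 F) = (fun x => Num.sqrt s * cos x)%R.
  by apply/funext => x; rewrite derive1E; case: (dF x).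
have cF' : continuous (derive1 F).
  rewrite F'E => x; apply: cvgM; [exact: cvg_cst|exact: continuous_cos].
have cF : continuous F.
  by move=> x; apply/differentiable_continuous/derivable1_diffP; case: (dF x).
have FN : F (- (pi / 2))%R = (- Num.sqrt s)%R by rewrite /F sinN sin_pihalf mulrN1.
have FP : F (pi / 2)%R = Num.sqrt s by rewrite /F sin_pihalf mulr1.
transitivity (\int[leb]_(t in `[F (- (pi / 2))%R, F (pi / 2)%R])
  (2 * Num.sqrt (s - t ^+ 2))%:E).
  rewrite FN FP [RHS]integral_mkcond; apply: eq_integral => t _.
  rewrite patchE; case: ifPn => //; rewrite notin_setE/= in_itv/= -ler_norml => /negP.
  rewrite -ltNge => st; rewrite ler0_sqrtr ?mulr0// subr_le0.
  by rewrite -(sqr_sqrtr (ltW s0)) -(real_normK (num_real t)) lerXn2r// ?nnegrE// ltW.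
rewrite integration_by_substitution_increasing//=; first last.
- apply: continuous_subspaceT => x; apply: cvgM; first exact: cvg_cst.
  apply: continuous_cvg; first exact: sqrt_continuous.
  by apply: cvgB; [exact: cvg_cst|exact: exprn_continuous].
- split; first by move=> x _; case: (dF x).
  + exact/cvg_at_right_filter/cF.
  + exact/cvg_at_left_filter/cF.
- by apply/cvg_ex; eexists; apply/cvg_at_left_filter; exact: cF'.
- by apply/cvg_ex; eexists; apply/cvg_at_right_filter; exact: cF'.
- by move=> x y xI yI; rewrite /F ltr_pM2l// => xy; rewrite ltr_sin.
- lra.
pose G (x : R) := (s * (x + sin x * cos x))%R.
transitivity (\int[leb]_(x in `[(- (pi / 2))%R, (pi / 2)%R]) (2 * s * cos x ^+ 2)%:E).
  apply: eq_integral => x; rewrite inE/= in_itv/= => xI; congr EFin.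
  rewrite fctE/= F'E /F exprMn sqr_sqrtr ?ltW//.
  have -> : (s - s * sin x ^+ 2 = s * cos x ^+ 2)%R by rewrite cos2sin2; ring.
  rewrite sqrtrM ?ltW// sqrtr_sqr ger0_norm; last exact: cos_ge0_pihalf.
  rewrite -[X in (2 * X * _)%R](sqr_sqrtr (ltW s0)); ring.
have dG (x : R) : is_derive x (1 : R)%R G (2 * s * cos x ^+ 2)%R.
  have h : is_derive x (1 : R)%R G (s *: (1 + (sin x *: - sin x + cos x *: cos x)))%R.
    by apply: is_deriveZ.
  apply: is_derive_eq h _.
  by rewrite /GRing.scale/=; have := cos2Dsin2 x; nra.
rewrite (integral_is_derive _ _ dG).
- by rewrite /G cosN cos_pihalf; congr EFin; field.
- lra.
- move=> x; apply: cvgM; first exact: cvg_cst.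
  by apply: cvgM; exact: continuous_cos.
Qed.

Lemma lebesgue_disk (s : R) : mu 2 [set w : Rn R 2 | (sqnorm w < s)%R] = (pi * Num.max
  0 s)%:E.
Proof.
have [s0|s0] := leP s 0%R.
  rewrite mulr0 (_ : [set w | _] = set0) ?measure0//.
  apply/seteqP; split => // w /=; apply/negP; rewrite -leNgt (le_trans s0)//.
  exact: sqnorm_ge0.
rewrite -integral_chords//.
have mA : measurable [set w : Rn R 2 | (sqnorm w < s)%R].
  have -> : [set w : Rn R 2 | (sqnorm w < s)%R] = @sqnorm R 2 @^-1` [set` `]-oo, s[].
    by apply/seteqP; split => w /=; rewrite in_itv.
  exact: (measurable_preimage (@measurable_sqnorm R 2)).
rewrite lebesgue_RnS1//; apply: eq_integral => t _.
rewrite -(lebesgue_sqr_lt (s - t ^+ 2)) -lebesgue_R1.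
  congr (mu 1 _); apply/seteqP; split => w /=;
    by rewrite sqnorm_consp /sqnorm big_ord1 ltrBrDl.
rewrite (_ : [set v : R | _] = (fun v : measurableTypeR R =>
  v ^+ 2)%R @^-1` [set` `]-oo, (s - t ^+ 2)%R[]).
  by apply: measurable_preimage => //; exact: measurable_funX.
by apply/seteqP; split => w /=; rewrite in_itv.
Qed.

(** Half lines generate the Borel sets, and both sides agree on them by the area
    of the disk. *)
Lemma sqnorm_image (A : set (measurableTypeR R)) : measurable A ->
  mu 2 (@sqnorm R 2 @^-1` A) = pi%:E * leb (A `&` `[0%R, +oo[).
Proof.
move=> mA.
have ms : measurable_fun setT (@sqnorm R 2 : Rn R 2 -> measurableTypeR R).
  exact: measurable_sqnorm.
pose F := isMeasurableFun.Build _ _ _ _ _ ms.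
pose g : {mfun Rn R 2 >-> measurableTypeR R} := HB.pack (@sqnorm R 2) F.
pose p : {nonneg R} := NngNum (pi_ge0 R).
have m0 : measurable (`[0%R, +oo[%classic : set (measurableTypeR R)) by [].
pose G : set (set R) := @RGenInftyO.G R.
have := @measure_unique _ R (measurableTypeR R) G (fun n => `]-oo, n%:R[%classic)
  _ _ _ _ (pushforward (mu 2) g) (mscale p (mrestr leb m0)).
apply => //.
- exact: RGenInftyO.measurableE.
- move=> _ _ [a ->] [b ->]; exists (Num.min a b).
  by apply/seteqP; split => x /=; rewrite !in_itv/= lt_min; [case=> -> ->|move/andP].
- by move=> i; exists i%:R.
- apply/seteqP; split => // x _; exists (Num.truncn `|x|).+1 => //=.
  by rewrite in_itv/= (le_lt_trans (ler_norm x))// truncnS_gt.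
- move=> _ [s ->]; rewrite /pushforward /= /mscale /mrestr/=.
  transitivity (mu 2 [set w : Rn R 2 | (sqnorm w < s)%R]).
    by congr (mu 2 _); apply/seteqP; split => w /=; rewrite in_itv.
  rewrite lebesgue_disk EFinM; congr (_ * _).
  transitivity (leb `[0%R, s[%classic).
    by rewrite lebesgue_measure_itv/= lte_fin; case: ltP => s0; rewrite ?sube0.
  congr (leb _); apply/seteqP; split => w /=; rewrite !in_itv/= andbT.
    by move=> /andP[].
  by case=> -> ->.
- move=> k; rewrite /pushforward.
  suff H : [set w : Rn R 2 | (sqnorm w < k%:R)%R] = g @^-1` `]-oo, k%:R[%classic.
    have : mu 2 [set w : Rn R 2 | (sqnorm w < k%:R)%R] < +oo by rewrite lebesgue_disk
      ltry.
    by rewrite H.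
  by apply/seteqP; split => w /=; rewrite in_itv.
Qed.

Lemma integral_mscale d (T : measurableType d) (m : {measure set T -> \bar R})
    (k : {nonneg R}) (D : set T) (f : T -> \bar R) : measurable D ->
  m.-integrable D f ->
  \int[mscale k m]_(x in D) f x = k%:num%:E * \int[m]_(x in D) f x.
Proof.
move=> mD fi; have mf : measurable_fun D f by case/integrableP : fi.
rewrite [LHS]integralE ge0_integral_mscale//; last exact: measurable_funepos.
rewrite ge0_integral_mscale//; last exact: measurable_funeneg.
rewrite -muleBr -?integralE//.
exact/fin_num_adde_defr/(integrable_pos_fin_num mD fi).
Qed.

(** Polar coordinates for radial functions, in the variable t = |x|^2. *)
Lemma integral_sqnorm (f : R -> R) (s : R) :
  leb.-integrable `[0%R, s] (EFin \o f) ->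
  \int[mu 2]_w (if (sqnorm w < s)%R then f (sqnorm w) else 0%R)%:E =
    pi%:E * \int[leb]_(t in `[0%R, s]) (f t)%:E.
Proof.
move=> fi; pose D := `[0%R, s[%classic : set (measurableTypeR R).
have mD : measurable D by exact: measurable_itv.
have fD : leb.-integrable D (EFin \o f).
  by apply: integrableS fi => //; apply: subset_itvl; rewrite bnd_simp.
have mf : measurable_fun D (EFin \o f) by case/integrableP : fD.
have ms : measurable_fun setT (@sqnorm R 2 : Rn R 2 -> measurableTypeR R).
  exact: measurable_sqnorm.
pose F := isMeasurableFun.Build _ _ _ _ _ ms.
pose g : {mfun Rn R 2 >-> measurableTypeR R} := HB.pack (@sqnorm R 2) F.
pose p : {nonneg R} := NngNum (pi_ge0 R).
transitivity (\int[pushforward (mu 2) g]_y ((EFin \o f) \_ D) y).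
  rewrite (@integral_image _ _ _ _ _ (mu 2) _ (@sqnorm R 2 : Rn R 2 -> measurableTypeR
    R))//.
  - apply: eq_integral => w _; rewrite patchE mem_setE/= in_itv/=.
    by rewrite sqnorm_ge0/=; case: ifPn.
  - exact/(measurable_restrictT _ mD).
rewrite -integral_mkcond.
rewrite (eq_measure_integral (mscale p leb)).
  rewrite integral_mscale// integral_itv_bndo_bndc//.
move=> A mA AD; apply: (eq_trans (sqnorm_image mA)); congr (_ * leb _).
by apply/setIidl => x /AD; rewrite /D/= !in_itv/= => /andP[->].
Qed.

End radial.

(** * Bessel functions *)

Section bessel_series.
Context (R : realType).

Definition besselC_coeff (m i : nat) : R := (-1) ^+ i / (i`! * (i + m)`!)%:R.

(** The Bessel-Clifford function of - t: it is entire in t, and it carries J_m as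
    J_m(x) = (x/2)^m besselC m (x^2/4), see [besselJE]. The variable t is the one in
    which radial integrals are computed, so that no square root is differentiated. *)
Definition besselC (m : nat) (t : R) : R := limn (pseries (besselC_coeff m) t).

Lemma is_cvg_besselC m t : cvgn (pseries (besselC_coeff m) t).
Proof.
apply: normed_cvg.
apply: (series_le_cvg _ _ _ (is_cvg_series_exp_coeff `|t|)) => n /=.
- exact: normr_ge0.
- exact: exp_coeff_ge0.
rewrite /besselC_coeff /exp_coeff/= !normrM normrX normrN1 expr1n mul1r normrX.
rewrite normfV normr_nat mulrC ler_wpM2l ?exprn_ge0//.
rewrite lef_pV2 ?posrE ?ltr0n ?muln_gt0 ?fact_gt0// ler_nat.
by rewrite leq_pmulr// fact_gt0.
Qed.

Lemma pseries_diffs_besselC m :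
  pseries_diffs (besselC_coeff m) = - besselC_coeff m.+1.
Proof.
apply/funext => i; rewrite /pseries_diffs /besselC_coeff !fctE exprS mulN1r.
rewrite factS addSnnS mulrC !natrM.
have : (i.+1%:R : R) != 0 by rewrite pnatr_eq0.
have : (i`!%:R : R) != 0 by rewrite pnatr_eq0 -lt0n fact_gt0.
have : ((i + m.+1)`!%:R : R) != 0 by rewrite pnatr_eq0 -lt0n fact_gt0.
move: (i.+1%:R : R) (i`!%:R : R) ((i + m.+1)`!%:R : R) => a b c c0 b0 a0.
by field; rewrite a0 b0 c0.
Qed.

Lemma pseriesN (c : R^nat) x : pseries (- c) x = - pseries c x.
Proof.
rewrite /pseries -seriesN; congr series; apply/funext => i; exact: mulNr.
Qed.

Lemma is_derive_besselC m (t : R) : is_derive t (1 : R) (besselC m) (- besselC m.+1 t).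
Proof.
have := @pseries_snd_diffs R (besselC_coeff m) (`|t| + 1) t.
rewrite pseries_diffs_besselC pseries_diffsN pseries_diffs_besselC opprK.
rewrite !pseriesN [- besselC m.+1 t](_ : _ = limn (- pseries (besselC_coeff m.+1) t)).
  apply; [exact: is_cvg_besselC| |exact: is_cvg_besselC|].
  - by apply: is_cvgN; exact: is_cvg_besselC.
  - by rewrite [ltRHS]ger0_norm// addrC -subr_gt0 addrK.
by rewrite limN//; exact: is_cvg_besselC.
Qed.

Lemma continuous_besselC m : continuous (besselC m).
Proof.
move=> x; apply/differentiable_continuous/derivable1_diffP.
by case: (is_derive_besselC m x).
Qed.

(** The series of t besselC 1 t, differentiated term by term; this is the relation
    (x J_1)' = x J_0. *)
Lemma is_derive_mul_besselC1 (t : R) :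
  is_derive t (1 : R) (fun t => t * besselC 1 t) (besselC 0 t).
Proof.
pose c i : R := if i is j.+1 then besselC_coeff 1 j else 0.
have cE x : pseries c x @ \oo --> x * besselC 1 x.
  rewrite -cvg_shiftS/=.
  rewrite (_ : (fun n => _) = (fun n => x * pseries (besselC_coeff 1) x n)).
    by apply: cvgM; [exact: cvg_cst|exact: is_cvg_besselC].
  apply/funext => n; rewrite /pseries /series/= big_nat_recl//= mul0r add0r.
  by rewrite mulr_sumr; apply: eq_bigr => i _; rewrite exprS mulrCA.
have dc : pseries_diffs c = besselC_coeff 0.
  apply/funext => i; rewrite /pseries_diffs.
  change (i.+1%:R * besselC_coeff 1 i = besselC_coeff 0 i).
  rewrite /besselC_coeff addn1 addn0 factS !natrM.
  have : (i.+1%:R : R) != 0 by rewrite pnatr_eq0.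
  have : (i`!%:R : R) != 0 by rewrite pnatr_eq0 -lt0n fact_gt0.
  move: (i.+1%:R : R) (i`!%:R : R) => a b b0 a0.
  by field; rewrite a0 b0.
rewrite (_ : (fun t => _) = fun x => limn (pseries c x)); last first.
  by apply/funext => x; apply/esym/cvg_lim.
have := @pseries_snd_diffs R c (`|t| + 1) t.
rewrite dc; apply.
- by apply/cvg_ex; eexists; exact: cE.
- exact: is_cvg_besselC.
- rewrite pseries_diffs_besselC pseriesN; apply: is_cvgN; exact: is_cvg_besselC.
- by rewrite [ltRHS]ger0_norm// addrC -subr_gt0 addrK.
Qed.

Lemma besselJE m x : besselJ m x = (x / 2) ^+ m * besselC m ((x / 2) ^+ 2).
Proof.
rewrite /besselJ; apply/cvg_lim => //.
rewrite (_ : series _ = fun n =>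
  (x / 2) ^+ m * pseries (besselC_coeff m) ((x / 2) ^+ 2) n).
  by apply: cvgM; [exact: cvg_cst|exact: is_cvg_besselC].
apply/funext => n; rewrite /pseries /series/= mulr_sumr; apply: eq_bigr => i _.
by rewrite -exprM mul2n exprD -[_ / _]/(besselC_coeff m i); ring.
Qed.

End bessel_series.

Section angular.
Context (R : realType).
Notation leb := (@lebesgue_measure R).
Variables p q : R.
Let g (x : R) : R := p * cos x + q * sin x.
Let rho : R := p ^+ 2 + q ^+ 2.
Let I (m : nat) : R := \int[leb]_(x in `[0, pi *+ 2]) (g x ^+ m).

Let dg x : is_derive (x : R) (1 : R) g (- p * sin x + q * cos x).
Proof.
have h : is_derive (x : R) (1 : R) g (p *: - sin x + q *: cos x) by apply: is_deriveD.
by apply: is_derive_eq h _; rewrite /GRing.scale/=; ring.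
Qed.

Let cg : continuous g.
Proof.
by move=> x; apply/differentiable_continuous/derivable1_diffP; case: (dg x).
Qed.

Let cgX m : continuous (fun x => g x ^+ m).
Proof.
move=> x.
exact: (@continuous_comp _ _ _ g (fun y =>
  y ^+ m) x (@cg x) (@exprn_continuous _ m (g x))).
Qed.

Let twopi_ge0 : 0 <= pi *+ 2 :> R.
Proof. by rewrite mulrn_wge0// pi_ge0. Qed.

Let igX m : leb.-integrable `[0, pi *+ 2] (EFin \o (fun x => g x ^+ m)).
Proof.
exact/continuous_integrable_itv/cgX.
Qed.

Let moment0 : I 0 = pi *+ 2.
Proof.
rewrite /I /Rintegral (eq_integral (cst 1%E))//.
rewrite integral_cst//= mul1e lebesgue_measure_itv/= lte_fin.
case: ltP => [_|h] /=; first by rewrite oppr0 addr0.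
by apply/eqP; rewrite eq_le twopi_ge0 h.
Qed.

(** Since g'' = - g and g^2 + g'^2 = rho, the derivative of g^(m+1) g' is
    (m+1) rho g^m - (m+2) g^(m+2), and its integral over a period is zero. *)
Let momentS m : m.+2%:R * I m.+2 = m.+1%:R * rho * I m.
Proof.
pose F x : R := g x ^+ m.+1 * (- p * sin x + q * cos x).
have dF x : is_derive (x : R)
  (1 : R) F (m.+1%:R * rho * g x ^+ m - m.+2%:R * g x ^+ m.+2).
  have d1 : is_derive x (1 : R) (fun x => g x ^+ m.+1)
      ((m.+1%:R * g x ^+ m) *: (- p * sin x + q * cos x)).
    have := @is_deriveX _ _ g m.+1 x 1 _ (dg x).
    by rewrite (_ : g ^+ m.+1 = (fun x => g x ^+ m.+1))// exprfctE.
  have d2 : is_derive (x : R) (1 : R) (fun x : R =>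
    - p * sin x + q * cos x) (- p *: cos x + q *: - sin x).
    by apply: is_deriveD.
  have h : is_derive x (1 : R) F _ := is_deriveM d1 d2.
  apply: is_derive_eq h _.
  rewrite /GRing.scale/=.
  have -> : - p * cos x + q * - sin x = - g x by rewrite /g; ring.
  have E : (- p * sin x + q * cos x) ^+ 2 = rho - g x ^+ 2.
    rewrite /rho /g -[p ^+ 2 + q ^+ 2]mulr1 -(cos2Dsin2 x); ring.
  transitivity (m.+1%:R * g x ^+ m * (- p * sin x + q * cos x) ^+ 2 - g x ^+ m.+2).
    by rewrite !exprS -mulr_natl; ring.
  by rewrite E !exprS -[m.+2%:R]natr1; ring.
have := @integral_is_derive R _ F 0 (pi *+ 2) twopi_ge0 _ dF.
have -> : F (pi *+ 2) - F 0 = 0.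
  by rewrite /F /g cos2pi sin2pi cos0 sin0 subrr.
move=> H; have : \int[leb]_(x in `[0, pi *+ 2])
   (m.+1%:R * rho * g x ^+ m - m.+2%:R * g x ^+ m.+2) = 0.
  rewrite /Rintegral H// => x.
  by apply: cvgB; (apply: cvgM; [exact: cvg_cst|exact: cgX]).
have iZ c k : leb.-integrable `[0, pi *+ 2] (EFin \o (fun x => c * g x ^+ k)).
  apply: continuous_integrable_itv => x; apply: cvgM; first exact: cvg_cst.
  exact: cgX.
rewrite RintegralB// !RintegralZl// => /eqP.
by rewrite subr_eq0 => /eqP <-.
Qed.

Let moment_even n : I n.*2 = pi *+ 2 * (n.*2)`!%:R / (4 ^+ n * n`!%:R ^+ 2) * rho ^+ n.
Proof.
elim: n => [|n ih]; first by rewrite /= moment0 !expr0 fact0; field.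
have n0 : (n`!%:R : R) != 0 by rewrite pnatr_eq0 -lt0n fact_gt0.
have n1 : ((n.*2).+2%:R : R) != 0 by rewrite pnatr_eq0.
have n2 : (n.+1%:R : R) != 0 by rewrite pnatr_eq0.
rewrite doubleS; apply: (mulfI n1); rewrite momentS ih !factS !natrM.
rewrite (_ : n.*2.+2 = n.+1 * 2)%N ?natrM; last by rewrite muln2.
have f0 : (4 ^+ n : R) != 0 by rewrite expf_neq0.
by rewrite !exprS; field; rewrite n0 nat1r n2 f0.
Qed.

(** Poisson's integral for J_0(sqrt (p^2 + q^2)): the even moments of g turn the
    power series of the cosine into that of besselC 0. *)
Lemma integral_cos_circle :
  \int[leb]_(x in `[0, pi *+ 2]) (cos (p * cos x + q * sin x)) =
  pi *+ 2 * besselC 0 (rho / 4).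
Proof.
pose S n x : R := series (cos_coeff' (g x)) n.
have SE n x : S n x = \sum_(0 <= i < n) ((-1) ^+ i / (i.*2)`!%:R * g x ^+ i.*2).
  by apply: eq_bigr => i _; rewrite /cos_coeff' mulrAC.
have cSx n : continuous (S n).
  elim: n => [|n ih].
    rewrite (_ : S 0 = cst 0); first by move=> x; exact: cvg_cst.
    by apply/funext => x; rewrite SE big_nil.
  rewrite (_ : S n.+1 = fun x => S n x + (-1) ^+ n / (n.*2)`!%:R * g x ^+ n.*2).
    move=> x; apply: cvgD; first exact: ih.
    by apply: cvgM; [exact: cvg_cst|exact: cgX].
  by apply/funext => x; rewrite !SE big_nat_recr.
have iS n : \int[leb]_(x in `[0, pi *+ 2]) S n x =
    pi *+ 2 * pseries (@besselC_coeff R 0) (rho / 4) n.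
  have iT i : leb.-integrable `[0, pi *+ 2]
      (EFin \o (fun x => (-1) ^+ i / (i.*2)`!%:R * g x ^+ i.*2)).
    by apply: continuous_integrable_itv => x; apply: cvgM; [exact: cvg_cst|exact: cgX].
  rewrite /pseries /series/= mulr_sumr.
  elim: n => [|n ih].
    rewrite big_nil /Rintegral (eq_integral (cst 0%E)) ?integral0// => x _.
    by rewrite SE big_nil.
  rewrite big_nat_recr//= -ih.
  rewrite (_ : \int[leb]_(x in _) S n.+1 x = \int[leb]_(x in `[0, pi *+ 2]) (S n x +
     (-1) ^+ n / (n.*2)`!%:R * g x ^+ n.*2)); last first.
    by apply: eq_Rintegral => x _; rewrite !SE big_nat_recr.
  rewrite RintegralD//; last first.
    exact: continuous_integrable_itv.
  congr (_ + _); rewrite RintegralZl// [LHS](congr1 _ (moment_even n)).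
  rewrite /besselC_coeff addn0 natrM exprMn exprVn.
  have n0 : (n`!%:R : R) != 0 by rewrite pnatr_eq0 -lt0n fact_gt0.
  have n1 : ((n.*2)`!%:R : R) != 0 by rewrite pnatr_eq0 -lt0n fact_gt0.
  have f0 : (4 ^+ n : R) != 0 by rewrite expf_neq0.
  by field; rewrite n0 n1 f0.
have cS x : S n x @[n --> \oo] --> cos (g x) by exact: cvg_cos_coeff'.
have grho x : g x ^+ 2 <= rho.
  rewrite -subr_ge0 (_ : rho - g x ^+ 2 = (- p * sin x + q * cos x) ^+ 2) ?sqr_ge0//.
  by rewrite /rho /g -[p ^+ 2 + q ^+ 2]mulr1 -(cos2Dsin2 x); ring.
have rho0 : 0 <= rho by rewrite addr_ge0// sqr_ge0.
have Sb n x : `|S n x| <= expR rho.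
  apply: (@le_trans _ _ (series (exp_coeff rho) n)).
    rewrite SE; apply: le_trans (ler_norm_sum _ _ _) _.
    apply: ler_sum => i _; rewrite !normrM normrX normrN1 expr1n mul1r normfV.
    rewrite normr_nat normrX -mul2n exprM real_normK ?num_real// /exp_coeff/= [X in X
      <= _]mulrC.
    apply: ler_pM => //; first by rewrite exprn_ge0// sqr_ge0.
    - by rewrite lerXn2r// ?nnegrE ?sqr_ge0.
    - rewrite lef_pV2 ?posrE ?ltr0n ?fact_gt0// ler_nat.
      by rewrite mul2n -addnn leq_fact ?leq_addr.
  apply: nondecreasing_cvgn_le; last exact: is_cvg_series_exp_coeff.
  by apply: nondecreasing_series => i _ _; exact: exp_coeff_ge0.
have ccos : continuous (fun x => cos (g x)).
  move=> x; exact: (@continuous_comp _ _ _ g cos x (@cg x) (@continuous_cos _ (g x))).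
have := @dominated_convergence _ _ _ leb `[0, pi *+ 2]%classic _
   (fun n x => (S n x)%:E) (fun x => (cos (g x))%:E) (cst (expR rho)%:E).
case => //.
- by move=> n; have /integrableP[] := continuous_integrable_itv 0 (pi *+ 2) (cSx n).
- by have /integrableP[] := continuous_integrable_itv 0 (pi *+ 2) ccos.
- by apply: aeW => x _; apply: cvg_EFin; [exact: nearW|exact: cS].
- exact: (@continuous_integrable_itv R (cst (expR rho)) 0 (pi *+ 2) (fun=> cvg_cst _)).
- by apply: aeW => x n _; rewrite lee_fin.
move=> _ _ lim_cos.
rewrite /Rintegral (_ : \int[leb]_(x in _) _ = (pi *+ 2 * besselC 0 (rho / 4))%:E)%E//.
apply: (cvg_unique _ lim_cos) => //.
rewrite (_ : [sequence _]_n = fun n =>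
  (pi *+ 2 * pseries (@besselC_coeff R 0) (rho / 4) n)%:E).
  apply: cvg_EFin; first exact: nearW.
  by apply: cvgM; [exact: cvg_cst|exact: is_cvg_besselC].
apply/funext => n; rewrite -iS /Rintegral fineK//.
by apply: integrable_fin_num => //; exact: continuous_integrable_itv.
Qed.

End angular.

Section bessel_products.
Context (R : realType).
Notation leb := (@lebesgue_measure R).

Let P (c t : R) : R := c * t * besselC 1 (c * t).
Let Q (c t : R) : R := besselC 0 (c * t).

Let dP (c t : R) : is_derive t (1 : R) (P c) (c * Q c t).
Proof.
have h := is_derive1_comp (is_derive_mul_besselC1 (c * t)) (is_derive_mull c t).
by apply: is_derive_eq h _; rewrite mulrC.
Qed.

Let dQ (c t : R) : is_derive t (1 : R) (Q c) (- (c * besselC 1 (c * t))).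
Proof.
have h := is_derive1_comp (is_derive_besselC 0 (c * t)) (is_derive_mull c t).
by apply: is_derive_eq h _; rewrite mulNr mulrC.
Qed.

Let cQ (c : R) : continuous (Q c).
Proof.
by move=> t; apply/differentiable_continuous/derivable1_diffP; case: (dQ c t).
Qed.

(** Lommel's integral: as P' = c Q and Q' = - c besselC 1, the products of
    derivatives cancel in the derivative of P_c Q_d - P_d Q_c. *)
Lemma integral_besselC_neq (c d s : R) : 0 <= s ->
  (c - d) * \int[leb]_(t in `[0, s]) (besselC 0 (c * t) * besselC 0 (d * t)) =
  P c s * Q d s - P d s * Q c s.
Proof.
move=> s0; pose G t := P c t * Q d t - P d t * Q c t.
have cg : continuous (fun t => (c - d) * (Q c t * Q d t)).
  by move=> t; apply: cvgM; [exact: cvg_cst|apply: cvgM; exact: cQ].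
have dG (t : R) : is_derive t (1 : R) G ((c - d) * (Q c t * Q d t)).
  have h : is_derive t (1 : R) G _ :=
    is_deriveB (is_deriveM (dP c t) (dQ d t)) (is_deriveM (dP d t) (dQ c t)).
  by apply: is_derive_eq h _; rewrite /GRing.scale/= /P /Q; ring.
rewrite -RintegralZl//; last first.
  apply: continuous_integrable_itv => t; apply: cvgM; exact: cQ.
rewrite /Rintegral (integral_is_derive s0 cg dG)/= /G.
by rewrite /P !mulr0 !mul0r subrr subr0.
Qed.

(** The confluent case of Lommel's integral, with primitive c t Q^2 + P^2. *)
Lemma integral_besselC_eq (c s : R) : 0 <= s ->
  c * \int[leb]_(t in `[0, s]) (besselC 0 (c * t) * besselC 0 (c * t)) =
  c * s * Q c s ^+ 2 + P c s ^+ 2.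
Proof.
move=> s0; pose G t := c * (t * (Q c t * Q c t)) + P c t * P c t.
have cg : continuous (fun t => c * (Q c t * Q c t)).
  by move=> t; apply: cvgM; [exact: cvg_cst|apply: cvgM; exact: cQ].
have dG (t : R) : is_derive t (1 : R) G (c * (Q c t * Q c t)).
  have h : is_derive t (1 : R) G _ :=
    is_deriveD (is_deriveZ c (is_deriveM (@is_derive_id _ _ t (1 : R))
      (is_deriveM (dQ c t) (dQ c t))))
     (is_deriveM (dP c t) (dP c t)).
  by apply: is_derive_eq h _; rewrite !fctE /GRing.scale/= /P /Q; ring.
rewrite -RintegralZl//; last first.
  apply: continuous_integrable_itv => t; apply: cvgM; exact: cQ.
rewrite /Rintegral (integral_is_derive s0 cg dG)/= /G.
by rewrite /P !mulr0 !mul0r; ring.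
Qed.

End bessel_products.

Section bessel_functions.
Context (R : realType).
Notation J := (@besselJ R).

(** Two ways to differentiate t besselC 1 t. *)
Lemma besselC_rec (t : R) : besselC 1 t - t * besselC 2 t = besselC 0 t.
Proof.
have d1 := is_deriveM (@is_derive_id _ _ t (1 : R)) (is_derive_besselC 1 t).
have d2 := is_derive_mul_besselC1 t.
have := @derive_val _ _ _ _ _ _ _ d1; rewrite (@derive_val _ _ _ _ _ _ _ d2) => ->.
by rewrite /GRing.scale/=; ring.
Qed.

Let d_half_sqr (x : R) : is_derive x (1 : R) (fun x => (x / 2) ^+ 2) (x / 2).
Proof.
have h : is_derive x (1 : R) (4^-1 \*: (id * id)) _ :=
  is_deriveZ 4^-1 (is_deriveM (@is_derive_id _ _ x (1 : R))
    (@is_derive_id _ _ x (1 : R))).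
rewrite (_ : (fun x => _) = 4^-1 \*: (id * id)); last first.
  by apply/funext => y; change ((y / 2) ^+ 2 = 4^-1 * (y * y)); field.
by apply: is_derive_eq h _; rewrite /GRing.scale/=; field.
Qed.

Lemma is_derive_besselJ0 (x : R) : is_derive x (1 : R) (J 0) (- J 1 x).
Proof.
have h := is_derive1_comp (g := fun x => (x / 2) ^+ 2)
  (is_derive_besselC 0 ((x / 2) ^+ 2)) (d_half_sqr x).
rewrite (_ : J 0 = besselC 0 \o (fun x => (x / 2) ^+ 2)); last first.
  by apply/funext => y; rewrite besselJE mul1r.
by apply: is_derive_eq h _; rewrite besselJE expr1 mulNr mulrC.
Qed.

Lemma is_derive_besselJ1 (x : R) : x != 0 ->
  is_derive x (1 : R) (J 1) (J 0 x - J 1 x / x).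
Proof.
move=> x0.
have h1 := is_derive1_comp (g := fun x => (x / 2) ^+ 2)
  (is_derive_besselC 1 ((x / 2) ^+ 2)) (d_half_sqr x).
have h := is_deriveM (is_deriveZ 2^-1 (@is_derive_id _ _ x (1 : R))) h1.
rewrite [X in is_derive _ _ X _](_ : J 1 = (2^-1 \*: id) * (besselC 1 \o (fun x =>
  (x / 2) ^+ 2))); last first.
  apply/funext => y; change (J 1 y = 2^-1 * y * besselC 1 ((y / 2) ^+ 2)).
  by rewrite besselJE expr1 [2^-1 * y]mulrC.
apply: is_derive_eq h _; rewrite !besselJE -besselC_rec /= /GRing.scale/= expr0 expr1.
by field.
Qed.

(** By Bessel's equation u = sqrt x J_0 satisfies u'' + (1 + 1/(4 x^2)) u = 0, so
    the energy E = u'^2 + (1 + 1/(4 x^2)) u^2 has derivative - u^2 / (2 x^3) and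
    decreases; in terms of J_0 and J_1 it is the function E of the proof. It
    dominates x (J_0^2 + J_1^2) / 2 for x >= 1. *)
Lemma besselJ_decay : exists2 M : R, 0 < M & forall x : R, 1 <= x ->
  `|J 0 x| <= M / Num.sqrt x /\ `|J 1 x| <= M / Num.sqrt x.
Proof.
pose E (x : R) := x * (J 0 x * J 0 x + J 1 x * J 1 x) - J 0 x * J 1 x + J 0 x * J 0 x *
  (2^-1 * x^-1).
have dE (x : R) : 0 < x -> is_derive x (1 : R) E (- (J 0 x ^+ 2 / (2 * x ^+ 2))).
  move=> x0; have xn0 : x != 0 by rewrite gt_eqF.
  have d0 := is_derive_besselJ0 x; have d1 := is_derive_besselJ1 xn0.
  have did := @is_derive_id _ _ x (1 : R).
  have dinv : is_derive x (1 : R) (fun x : R => x^-1) _ := is_deriveV xn0 did.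
  have h : is_derive x (1 : R) E _ := is_deriveD (is_deriveB
    (is_deriveM did (is_deriveD (is_deriveM d0 d0) (is_deriveM d1 d1)))
    (is_deriveM d0 d1)) (is_deriveM (is_deriveM d0 d0) (is_deriveZ 2^-1 dinv)).
  by apply: is_derive_eq h _; rewrite !fctE /= /GRing.scale/=; field.
have Edecr x : 1 <= x -> E x <= E 1.
  move=> x1; apply: (@ler0_derive1_nincr _ E 1 x) => //.
  - by move=> y; rewrite in_itv/= => /andP[y1 _]; case: (dE y (lt_trans ltr01 y1)).
  - move=> y; rewrite in_itv/= => /andP[y1 _]; have [_ e] := dE y (lt_trans ltr01 y1).
    by rewrite derive1E e oppr_le0 divr_ge0 ?sqr_ge0// mulr_ge0// sqr_ge0.
  - apply: derivable_within_continuous => y; rewrite in_itv/= => /andP[y1 _].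
    by case: (dE y (lt_le_trans ltr01 y1)).
have bound x : 1 <= x -> J 0 x ^+ 2 + J 1 x ^+ 2 <= 2 * E 1 / x.
  move=> x1; have x0 : 0 < x by rewrite (lt_le_trans ltr01).
  rewrite ler_pdivlMr//; apply: le_trans (_ : _ <= 2 * E x) _;
    last by rewrite ler_pM2l ?Edecr.
  have h : 0 <= J 0 x * J 0 x * (2^-1 * x^-1).
    by rewrite -expr2 mulr_ge0 ?sqr_ge0// mulr_ge0// invr_ge0 ltW.
  have h1 := sqr_ge0 (J 0 x - J 1 x).
  have h2 : J 0 x ^+ 2 + J 1 x ^+ 2 <= x * (J 0 x ^+ 2 + J 1 x ^+ 2).
    by rewrite ler_peMl// addr_ge0// sqr_ge0.
  rewrite /E; move: h h1 h2; set e := _ * (2^-1 * x^-1); nra.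
exists (Num.sqrt (2 * E 1) + 1); first by rewrite ltr_wpDl// sqrtr_ge0.
move=> x x1; have x0 : 0 < x by rewrite (lt_le_trans ltr01).
have key y : y ^+ 2 <= J 0 x ^+ 2 + J 1 x ^+ 2 -> `|y| <= (Num.sqrt (2 * E 1) + 1) /
  Num.sqrt x.
  move=> yJ; rewrite -sqrtr_sqr; apply: (@le_trans _ _ (Num.sqrt (2 * E 1 / x))).
    by rewrite ler_wsqrtr// (le_trans yJ)// bound.
  rewrite sqrtrM; last first.
    have := bound 1 (lexx _); rewrite divr1; apply: le_trans.
    by rewrite addr_ge0 ?sqr_ge0.
  by rewrite (sqrtrV (ltW x0)) ler_wpM2r ?invr_ge0 ?sqrtr_ge0// lerDl.
by split; apply: key; rewrite ?lerDl ?lerDr sqr_ge0.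
Qed.

End bessel_functions.

(** * Integrals over balls *)

Section ball_integrals.
Context (R : realType).
Notation leb := (@lebesgue_measure R).
Notation mu n := (lebesgue_Rn R n).

Lemma enorm_lt n (x : Rn R n) r : 0 < r -> (enorm x < r) = (sqnorm x < r ^+ 2).
Proof.
move=> r0; rewrite -[in RHS](sqr_sqrtr (sqnorm_ge0 x)).
by rewrite ltr_pXn2r// nnegrE ?sqrtr_ge0 ?ltW.
Qed.

Definition dotp n (a x : Rn R n) : R := \sum_(l < n) tnth a l * tnth x l.

Lemma measurable_dotp n (a : Rn R n) : measurable_fun setT (dotp a).
Proof.
apply: measurable_sum => i.
exact: (measurable_funM (measurable_cst _) (measurable_tnth i)).
Qed.

Lemma measurable_cube n r : measurable (cube r : set (Rn R n)).
Proof.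
rewrite (_ : cube r = \bigcap_(l in [set: 'I_n]) [set x | `|tnth x l| < r]).
  apply: fin_bigcap_measurable => // l _.
  rewrite (_ : [set x | _] = (fun x => `|tnth x l|) @^-1` [set` `]-oo, r[]).
    apply: measurable_preimage => //.
    exact: (measurableT_comp (normr_measurable (D := setT)) (measurable_tnth l)).
  by apply/seteqP; split => x /=; rewrite in_itv.
by apply/seteqP; split => x /= h; [move=> l _; exact: h|move=> l; exact: h].
Qed.

Lemma lebesgue_cube_lty n r : (mu n (cube r) < +oo)%E.
Proof.
elim: n => [|n ih].
  apply: le_lt_trans (_ : _ <= (mu 0 setT))%E _ => //.
    by apply: le_measure; rewrite ?inE//; exact: measurable_cube.
  by rewrite (_ : mu 0 setT = 1%E) ?ltry//; exact: diracT.
rewrite lebesgue_RnS.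
rewrite (_ : _ @^-1` _ = [set` `]-r, r[] `*` (cube r)).
  rewrite product_measure1E//; last exact: measurable_cube.
  rewrite lte_mul_pinfty// [X in X \is a fin_num]lebesgue_measure_itv/=.
  by case: ifPn => //; rewrite -EFinB.
apply/seteqP; split => -[t w] /=.
  move=> h; split; first by have := h ord0; rewrite tnth0 in_itv/= -ltr_norml.
  by move=> l; have := h (lift ord0 l); rewrite tnthS.
move=> [h1 h2] l; case: (unliftP ord0 l) => [m ->|->]; first by rewrite tnthS; exact: h2.
by rewrite tnth0; move: h1; rewrite in_itv/= -ltr_norml.
Qed.

Lemma ball_cube n r (x : Rn R n) : 0 < r -> sqnorm x < r ^+ 2 -> cube r x.
Proof.
move=> r0 xr l; rewrite -(ltr_pXn2r (n := 2))// ?nnegrE ?ltW//.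
rewrite real_normK ?num_real//; apply: le_lt_trans xr.
by rewrite /sqnorm (bigD1 l)//= lerDl; apply: sumr_ge0 => i _; exact: sqr_ge0.
Qed.

Definition on_ball n (r : R) (f : Rn R n -> R) (x : Rn R n) : R :=
  if sqnorm x < r ^+ 2 then f x else 0.

Lemma measurable_on_ball n r (f : Rn R n -> R) :
  measurable_fun setT f -> measurable_fun setT (on_ball r f).
Proof.
move=> mf; apply: measurable_fun_ifT => //.
exact: (measurable_fun_ltr (measurable_sqnorm (n := n)) (measurable_cst (r ^+ 2))).
Qed.

Lemma integrable_on_ball n r (M : R) (f : Rn R n -> R) : 0 < r ->
  measurable_fun setT f -> (forall x, sqnorm x < r ^+ 2 -> `|f x| <= M) ->
  (mu n).-integrable setT (EFin \o on_ball r f).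
Proof.
move=> r0 mf fM.
have -> : EFin \o on_ball r f = (EFin \o on_ball r f) \_ (cube r).
  apply/funext => x; rewrite patchE; case: ifPn => // xc.
  rewrite /= /on_ball ifF//; apply/negP => /(ball_cube r0) h.
  by move: xc; rewrite notin_setE; apply.
apply/integrable_restrict => //; first exact: measurable_cube.
rewrite setTI; apply: measurable_bounded_integrable.
- exact: measurable_cube.
- exact: lebesgue_cube_lty.
- by apply: measurable_funS (measurable_on_ball r mf).
- exists `|M|; split; first exact: num_real.
  move=> N MN x _; rewrite /= /on_ball; case: ifPn => [/fM h|_].
    exact: le_trans h (le_trans (ler_norm M) (ltW MN)).
  by rewrite normr0 (le_trans _ (ltW MN)).
Qed.

Lemma sqnorm_rot n (i j : 'I_n) (c s : R) (x : Rn R n) : i != j ->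
  c ^+ 2 + s ^+ 2 = 1 -> sqnorm (rot i j c s x) = sqnorm x.
Proof.
move=> ij cs1; have ji : j != i by rewrite eq_sym.
rewrite /sqnorm !(bigD1 i (P := predT))//= !(bigD1 j (P := fun k => k != i))//=.
rewrite !tnth_mktuple eqxx (negbTE ji) eqxx !addrA; congr (_ + _).
  rewrite -[RHS]mul1r -cs1; ring.
by apply: eq_bigr => k /andP[/negbTE ki /negbTE kj]; rewrite tnth_mktuple ki kj.
Qed.

(** The central symmetry is reached by flipping the coordinates one by one. *)
Lemma tnth_flips n (s : seq 'I_n) (x : Rn R n) k : uniq s ->
  tnth (foldr (@flip R n) x s) k = if k \in s then - tnth x k else tnth x k.
Proof.
elim: s k => //= i s ih k /andP[iNs us]; rewrite /flip tnth_mktuple in_cons !ih//.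
by case: eqVneq => [->|] //=; rewrite (negbTE iNs).
Qed.

Definition oppt n (x : Rn R n) : Rn R n := [tuple - tnth x i | i < n].

Lemma lebesgue_preserving_oppt n : lebesgue_preserving (@oppt n).
Proof.
have H (s : seq 'I_n) : lebesgue_preserving (fun x => foldr (@flip R n) x s).
  elim: s => [|i s ih]; first by split => [|A mA]; [exact: measurable_id|].
  change (lebesgue_preserving (@flip R n i \o (fun x => foldr (@flip R n) x s))).
  by apply: lebesgue_preserving_comp => //; exact: lebesgue_preserving_flip.
have := H (enum 'I_n); congr (lebesgue_preserving _); apply/funext => x;
  apply: eq_from_tnth => k.
by rewrite tnth_flips ?enum_uniq// mem_enum/= tnth_mktuple.
Qed.

Lemma integral_odd n (f : Rn R n -> R) : measurable_fun setT f ->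
  (forall x, f (oppt x) = - f x) -> (mu n).-integrable setT (EFin \o f) ->
  \int[mu n]_x f x = 0.
Proof.
move=> mf fN fi.
have : \int[mu n]_x f x = - \int[mu n]_x f x.
  rewrite {1}/Rintegral -(integral_lebesgue_preserving (lebesgue_preserving_oppt n))/=;
    last exact/measurable_EFinP.
  under eq_integral do rewrite fN EFinN.
  rewrite integralN; last exact: integrable_add_def.
  by rewrite fineN.
lra.
Qed.

End ball_integrals.

(** * Plane waves over the disk *)

Section disk.
Context (R : realType).
Notation leb := (@lebesgue_measure R).
Notation mu n := (lebesgue_Rn R n).

Lemma dotp2 (a x : Rn R 2) : dotp a x = tnth a ord0 * tnth x ord0 +
  tnth a (lift ord0 ord0) * tnth x (lift ord0 ord0).
Proof. by rewrite /dotp !big_ord_recl big_ord0 addr0. Qed.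

Let rot2 (t : R) (x : Rn R 2) : Rn R 2 :=
  rot ord0 (lift ord0 ord0) (cos t) (sin t) x.

Let sqnorm_rot2 t x : sqnorm (rot2 t x) = sqnorm x.
Proof. by apply: sqnorm_rot => //; exact: cos2Dsin2. Qed.

Let rot2_preserving t : lebesgue_preserving (rot2 t).
Proof. by apply: lebesgue_preserving_rot => //; exact: cos2Dsin2. Qed.

Let measurable_rot2 : measurable_fun setT
  (fun p : measurableTypeR R * Rn R 2 => rot2 p.1 p.2).
Proof.
have mc : measurable_fun setT (fun p : measurableTypeR R * Rn R 2 => cos p.1 : R).
  by apply: (measurableT_comp (continuous_measurable_fun (@continuous_cos R))).
have ms : measurable_fun setT (fun p : measurableTypeR R * Rn R 2 => sin p.1 : R).
  by apply: (measurableT_comp (continuous_measurable_fun (@continuous_sin R))).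
have mt k : measurable_fun setT (fun p : measurableTypeR R * Rn R 2 => tnth p.2 k : R).
  by apply: (measurableT_comp (measurable_tnth k)).
apply/measurable_fun_tnthP => k.
rewrite (_ : _ \o _ = fun p => tnth (rot2 p.1 p.2) k)//.
under eq_fun do rewrite /rot2 /rot tnth_mktuple.
have [_|_] := eqVneq k ord0.
  exact: (measurable_funB (measurable_funM mc (mt _)) (measurable_funM ms (mt _))).
have [_|_] := eqVneq k (lift ord0 ord0); last exact: mt.
exact: (measurable_funD (measurable_funM ms (mt _)) (measurable_funM mc (mt _))).
Qed.

(** Every rotation leaves the integral of f unchanged, so it may be averaged over
    the angle, and Fubini's theorem exchanges the two integrals. *)
Lemma integral_rot_mean (f : Rn R 2 -> R) : measurable_fun setT f ->
  (mu 2).-integrable setT (EFin \o f) ->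
  ((pi *+ 2)%:E * \int[mu 2]_x (f x)%:E =
   \int[mu 2]_x \int[leb]_(t in `[0%R, (pi *+ 2)%R]) (f (rot2 t x))%:E)%E.
Proof.
move=> mf fi.
have p0 : 0 <= pi *+ 2 :> R by rewrite mulrn_wge0// pi_ge0.
pose D : set (measurableTypeR R) := `[0, pi *+ 2]%classic.
have lebI : leb D = (pi *+ 2)%:E.
  rewrite /D lebesgue_measure_itv/= lte_fin; case: ltP => h; first by rewrite sube0.
  by congr EFin; apply/eqP; rewrite eq_le p0 h.
have mD : measurable D by exact: measurable_itv.
pose F (p : measurableTypeR R * Rn R 2) : R := \1_D p.1 * f (rot2 p.1 p.2).
have FE t x : (F (t, x))%:E = ((fun t => (f (rot2 t x))%:E) \_ D) t.
  by rewrite /F/= patchE indicE; case: (t \in D); rewrite ?mul1r ?mul0r.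
have mF : measurable_fun setT (EFin \o F).
  apply/measurable_EFinP; apply: measurable_funM.
    exact: (measurableT_comp (measurable_indic (D := setT) mD)).
  exact: (measurableT_comp mf measurable_rot2).
have inner (g : R -> R) : g 0 = 0 -> measurable_fun setT (g \o f) ->
    (\int[leb]_t \int[mu 2]_x (g (F (t, x)))%:E =
    \int[leb]_(t in D) \int[mu 2]_x (g (f x))%:E)%E.
  move=> g0 mgf; rewrite [RHS]integral_mkcond; apply: eq_integral => t _.
  rewrite patchE /F /= indicE; case: ifPn => _.
    rewrite -(integral_lebesgue_preserving (rot2_preserving t) (f := EFin \o (g \o f)))//.
      by apply: eq_integral => x _; rewrite mul1r.
    exact/measurable_EFinP.
  by rewrite integral0_eq// => x _; rewrite mul0r g0.
have Fi : (leb \x mu 2)%E.-integrable setT (EFin \o F).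
  apply/(integrable12ltyP leb (mu 2) mF) => /=.
  rewrite [ltLHS](_ : _ = \int[leb]_(t in D) \int[mu 2]_x (Num.norm (f x))%:E)%E;
    last first.
    by rewrite -inner ?normr0//;
      exact: (measurableT_comp (normr_measurable (D := setT)) mf).
  have /integrableP[_ fi'] := fi.
  rewrite (@integral_cst _ _ _ leb D mD (\int[mu 2]_x (Num.norm (f x))%:E)%E).
  rewrite [X in (_ * X)%E]lebI lte_mul_pinfty ?integral_ge0//.
    by rewrite ge0_fin_numE ?integral_ge0.
  exact: ltry.
have := Fubini Fi; rewrite /= (inner idfun)// => H.
transitivity (\int[leb]_(t in D) \int[mu 2]_x (f x)%:E)%E.
  rewrite -(fineK (integrable_fin_num measurableT fi)).
  by rewrite (@integral_cst _ _ _ leb D mD) [X in _ = (_ * X)%E]lebI muleC.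
rewrite H; apply: eq_integral => x _; rewrite [RHS]integral_mkcond.
by apply: eq_integral => t _; rewrite -FE.
Qed.

(** For p = a . x, and q its value at x turned by a right angle, the phase at the
    rotated point is p cos t + q sin t with p^2 + q^2 = |a|^2 |x|^2: averaging over
    t produces Poisson's integral, and leaves a radial function. *)
Lemma integral_disk_cos (h : R -> R) (a : Rn R 2) (r : R) : 0 < r -> continuous h ->
  \int[mu 2]_x (on_ball r (fun x => h (sqnorm x) * cos (dotp a x)) x) =
  pi * \int[leb]_(t in `[0, r ^+ 2]) (h t * besselC 0 (sqnorm a * t / 4)).
Proof.
move=> r0 ch.
have [M hM] := continuous_itv_bounded 0 (r ^+ 2) ch.
have mf : measurable_fun setT (fun x : Rn R 2 => h (sqnorm x) * cos (dotp a x)).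
  apply: measurable_funM.
    exact: (measurableT_comp (continuous_measurable_fun ch) (@measurable_sqnorm R 2)).
  exact: (measurableT_comp (continuous_measurable_fun (@continuous_cos R))
    (measurable_dotp a)).
have fi : (mu 2).-integrable setT
    (EFin \o on_ball r (fun x : Rn R 2 => h (sqnorm x) * cos (dotp a x))).
  apply: (integrable_on_ball (M := M)) => // x xr.
  rewrite normrM -[M]mulr1; apply: ler_pM => //.
    by apply: hM; rewrite sqnorm_ge0 ltW.
  by rewrite ler_norml cos_geN1 cos_le1.
have := integral_rot_mean (measurable_on_ball r mf) fi.
pose w t : R := h t * besselC 0 (sqnorm a * t / 4).
have cw : continuous w.
  move=> t; apply: cvgM; first exact: ch.
  apply: (@continuous_comp _ _ _ (fun t => sqnorm a * t / 4) (besselC 0) t);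
    last exact: continuous_besselC.
  by apply: cvgM; [apply: cvgM; [exact: cvg_cst|exact: cvg_id]|exact: cvg_cst].
have wi := @continuous_integrable_itv R w 0 (r ^+ 2) cw.
rewrite [X in _ = X -> _](_ : _ =
  (pi%:E * \int[leb]_(t in `[0%R, (r ^+ 2)%R]) (pi *+ 2 * w t)%:E)%E).
  move=> E.
  have p0 : pi *+ 2 != 0 :> R by rewrite mulrn_eq0/= gt_eqF// pi_gt0.
  apply: (mulfI p0).
  have wi2 : leb.-integrable `[0, r ^+ 2] (EFin \o (fun t => pi *+ 2 * w t)).
    by apply: continuous_integrable_itv => t; apply: cvgM; [exact: cvg_cst|exact: cw].
  have := congr1 fine E.
  rewrite -(fineK (integrable_fin_num measurableT fi)).
  have mD : measurable (`[0, r ^+ 2]%classic : set (measurableTypeR R)).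
    exact: measurable_itv.
  rewrite -(fineK (integrable_fin_num mD wi2)) -!EFinM /=.
  by rewrite [X in _ = pi * X -> _](RintegralZl _ mD wi) => ->; rewrite mulrCA.
rewrite -(@integral_sqnorm _ (fun t => pi *+ 2 * w t)); last first.
  by apply: continuous_integrable_itv => t; apply: cvgM; [exact: cvg_cst|exact: cw].
apply: eq_integral => x _; rewrite /on_ball.
under eq_integral do rewrite sqnorm_rot2.
case: ifPn => _; last exact: integral0.
set p := dotp a x; pose q :=
  tnth a (lift ord0 ord0) * tnth x ord0 - tnth a ord0 * tnth x (lift ord0 ord0).
transitivity (\int[leb]_(t in `[0%R, (pi *+ 2)%R])
    ((h (sqnorm x))%:E * (cos (p * cos t + q * sin t))%:E))%E.
  apply: eq_integral => t _; rewrite -EFinM; congr (_ * cos _)%:E.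
  by rewrite /p /q !dotp2 !tnth_mktuple/=; ring.
have ci : leb.-integrable `[0, pi *+ 2] (EFin \o (fun t => cos (p * cos t + q * sin t))).
  apply: continuous_integrable_itv => t.
  apply: (@continuous_comp _ _ _ (fun t => p * cos t + q * sin t) cos t);
    last exact: continuous_cos.
  by apply: cvgD; (apply: cvgM; first exact: cvg_cst);
    [exact: continuous_cos|exact: continuous_sin].
have mD : measurable (`[0, pi *+ 2]%classic : set (measurableTypeR R)).
  exact: measurable_itv.
rewrite integralZl//= -(fineK (integrable_fin_num mD ci)) -EFinM; congr EFin.
rewrite [X in _ * X](integral_cos_circle p q) /w mulrCA;
  congr (_ * (_ * besselC 0 (_ / 4))).
by rewrite /p /q !dotp2 !sqnorm2; ring.
Qed.

End disk.

(** * Plane waves over the ball of space *)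

Section ball3.
Context (R : realType).
Notation leb := (@lebesgue_measure R).
Notation mu n := (lebesgue_Rn R n).

Let o0 : 'I_3 := ord0.
Let o1 : 'I_3 := lift ord0 ord0.
Let o2 : 'I_3 := lift ord0 (lift ord0 ord0).

Lemma sqnorm3 (x : Rn R 3) : sqnorm x = tnth x o0 ^+ 2 + tnth x o1 ^+ 2 + tnth x o2 ^+ 2.
Proof. by rewrite /sqnorm !big_ord_recl big_ord0 addr0 addrA. Qed.

Lemma dotp3 (a x : Rn R 3) :
  dotp a x = tnth a o0 * tnth x o0 + tnth a o1 * tnth x o1 + tnth a o2 * tnth x o2.
Proof. by rewrite /dotp !big_ord_recl big_ord0 addr0 addrA. Qed.

Lemma unit_direction (u v : R) : exists c s, [/\ c ^+ 2 + s ^+ 2 = 1,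
  u * c + v * s = Num.sqrt (u ^+ 2 + v ^+ 2) & v * c - u * s = 0].
Proof.
have [uv0|uv0] := eqVneq (u ^+ 2 + v ^+ 2) 0.
  move/eqP : (uv0); rewrite paddr_eq0 ?sqr_ge0// !sqrf_eq0 => /andP[/eqP -> /eqP ->].
  exists 1, 0; split; first by rewrite expr1n expr0n addr0.
    by rewrite !mul0r expr0n addr0 sqrtr0.
  by rewrite !mul0r subrr.
have uv_ge0 : 0 <= u ^+ 2 + v ^+ 2 by rewrite addr_ge0 ?sqr_ge0.
set m := Num.sqrt _.
have mE : m ^+ 2 = u ^+ 2 + v ^+ 2 by rewrite sqr_sqrtr.
have m0 : m != 0 by rewrite -sqrf_eq0 mE.
exists (u / m), (v / m); split; last by ring.
  by rewrite !exprMn -mulrDl -mE exprVn divff// sqrf_eq0.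
by rewrite mulrA mulrA -mulrDl -!expr2 -mE expr2 mulfK.
Qed.

Section fixed_radius.
Variables (h : R -> R) (r : R).
Hypotheses (r0 : 0 < r) (ch : continuous h).

Let kern (a x : Rn R 3) := h (sqnorm x) * cos (dotp a x).

Let mkern a : measurable_fun setT (kern a).
Proof.
apply: measurable_funM.
  exact: (measurableT_comp (continuous_measurable_fun ch) (@measurable_sqnorm R 3)).
exact: (measurableT_comp (continuous_measurable_fun (@continuous_cos R))
  (measurable_dotp a)).
Qed.

Let axis (b : R) : Rn R 3 := [tuple if i == o0 then b else 0 | i < 3].

(** A first rotation, in the plane of the last two coordinates, kills the third
    component of a; a second one, in the plane of the first two, kills what is then
    the second component. *)
Lemma integral_ball_axis (a : Rn R 3) :
  (\int[mu 3]_x (on_ball r (kern a) x)%:E =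
   \int[mu 3]_x (on_ball r (kern (axis (Num.sqrt (sqnorm a)))) x)%:E)%E.
Proof.
have [c [s [cs1 cs2 cs3]]] := unit_direction (tnth a o1) (tnth a o2).
have [d [t [dt1 dt2 dt3]]] := unit_direction (tnth a o0)
  (Num.sqrt (tnth a o1 ^+ 2 + tnth a o2 ^+ 2)).
pose S := @rot R 3 o1 o2 c s; pose T := @rot R 3 o0 o1 d t.
have mST : lebesgue_preserving (S \o T) by apply: lebesgue_preserving_comp;
  apply: lebesgue_preserving_rot.
rewrite -(integral_lebesgue_preserving mST (f := EFin \o on_ball r (kern a))); last first.
  apply/measurable_EFinP; exact: (measurable_on_ball r (mkern a)).
apply: eq_integral => x _; congr EFin; rewrite /on_ball /kern.
have -> : sqnorm ((S \o T) x) = sqnorm x by rewrite /= !sqnorm_rot.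
case: ifPn => // _; congr (_ * cos _).
rewrite !dotp3 /= !tnth_mktuple/= mul0r addr0 mul0r addr0.
rewrite (_ : sqnorm a = tnth a o0 ^+ 2 + Num.sqrt (tnth a o1 ^+ 2 + tnth a o2 ^+ 2) ^+ 2).
  set rho := Num.sqrt (_ + _) in cs2 dt2 dt3 *.
  rewrite -dt2.
  move: (tnth x o0) (tnth x o1) (tnth x o2) => x0 x1 x2.
  transitivity (tnth a o0 * (d * x0 - t * x1) +
     (tnth a o1 * c + tnth a o2 * s) * (t * x0 + d * x1) +
     (tnth a o2 * c - tnth a o1 * s) * x2); first ring.
  rewrite cs3 cs2 mul0r addr0.
  transitivity ((tnth a o0 * d + rho * t) * x0 + (rho * d - tnth a o0 * t) * x1);
    first ring.
  by rewrite dt3 mul0r addr0.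
by rewrite sqr_sqrtr ?addr_ge0 ?sqr_ge0// addrA -sqnorm3.
Qed.

(** On the slice at height t the integrand is radial in the other two variables. *)
Lemma integral_ball_slice (a : Rn R 3) :
  (\int[mu 3]_x (on_ball r (kern a) x)%:E =
   \int[leb]_t ((pi * cos (Num.sqrt (sqnorm a) * t))%:E *
     \int[leb]_(u in `[0%R, (r ^+ 2 - t ^+ 2)%R]) (h (t ^+ 2 + u))%:E))%E.
Proof.
rewrite integral_ball_axis; set b := Num.sqrt _.
have [M hM] := continuous_itv_bounded 0 (r ^+ 2) ch.
rewrite fubini_consp; last first.
  apply: (integrable_on_ball (M := M)) => // x xr.
  rewrite normrM -[M]mulr1; apply: ler_pM => //.
    by apply: hM; rewrite sqnorm_ge0 ltW.
  by rewrite ler_norml cos_geN1 cos_le1.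
apply: eq_integral => t _.
have ct : continuous (fun u => h (t ^+ 2 + u)).
  move=> u; apply: (@continuous_comp _ _ _ (fun u => t ^+ 2 + u) h u); last exact: ch.
  by apply: cvgD; [exact: cvg_cst|exact: cvg_id].
have mD : measurable (`[0, r ^+ 2 - t ^+ 2]%classic : set (measurableTypeR R)).
  exact: measurable_itv.
have hi := continuous_integrable_itv 0 (r ^+ 2 - t ^+ 2) ct.
rewrite EFinM -muleA -integralZl//= -integral_sqnorm; last first.
  by apply: continuous_integrable_itv => u; apply: cvgM; [exact: cvg_cst|exact: ct].
apply: eq_integral => w _; congr EFin; rewrite /on_ball /kern.
rewrite sqnorm_consp -ltrBrDl; case: ifPn => // _; rewrite mulrC; congr (cos _ * _).
by rewrite dotp3 !tnth_mktuple/= tnth0 !mul0r !addr0.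
Qed.

End fixed_radius.
End ball3.

Section ball3_spherical.
Context (R : realType).
Notation leb := (@lebesgue_measure R).
Notation mu n := (lebesgue_Rn R n).

(** At 0 this is the derivative of the sine. *)
Lemma continuous_sphj0 : continuous (@sphj0 R).
Proof.
move=> x; have [->|x0] := eqVneq x 0.
  apply/continuous_withinNx; rewrite {2}/sphj0 eqxx.
  have [dsin] := is_derive_sin (0 : R); rewrite cos0 => D1.
  have H : (fun h : R => h^-1 *: ((@sin R \o shift 0)
    (h *: (1 : R)) - sin 0)) @ 0^' --> (1 : R).
    case/cvg_ex : dsin => l hl.
    by rewrite -[X in _ --> X]D1 /derive [X in _ --> X](cvg_lim _ hl).
  apply: cvg_trans H; apply: near_eq_cvg; near=> y.
  have y0 : y != 0 by near: y; exact: nbhs_dnbhs_neq.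
  by rewrite /sphj0 (negbTE y0) /= sin0 subr0 addr0 /GRing.scale/= mulr1 mulrC.
have H : (fun x : R => sin x / x) @ x --> sin x / x.
  by apply: cvgM; [exact: continuous_sin|apply: cvgV => //; exact: cvg_id].
rewrite /continuous_at {2}/sphj0 (negbTE x0).
apply: cvg_trans H; apply: near_eq_cvg; near=> y.
rewrite /sphj0 ifF//; apply/negbTE; near: y.
by apply: (cvgr_neq0 x) => //; exact: cvg_id.
Unshelve. all: by end_near. Qed.

Variables (k r : R).
Hypotheses (k0 : 0 < k) (r0 : 0 < r).

Let h (u : R) : R := sphj0 (k * Num.sqrt u).

Let ch : continuous h.
Proof.
move=> u; apply: (@continuous_comp _ _ _ (fun u => k * Num.sqrt u) (@sphj0 R) u).
  by apply: cvgM; [exact: cvg_cst|exact: sqrt_continuous].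
exact: continuous_sphj0.
Qed.

(** The integrand has the primitive - 2 cos (k sqrt (t^2 + u)) / k^2 in u, which is
    differentiable for u > 0 and continuous up to u = 0. *)
Lemma integral_sphj0_sqrt (t : R) :
  (\int[leb]_(u in `[0%R, (r ^+ 2 - t ^+ 2)%R]) (h (t ^+ 2 + u))%:E =
  (if `|t| <= r then 2 / k ^+ 2 * (cos (k * t) - cos (k * r)) else 0)%:E)%E.
Proof.
have tr : (t ^+ 2 < r ^+ 2) = (`|t| < r).
  by rewrite -(ltr_pXn2r (n := 2) _ (x := `|t|))// ?nnegrE ?ltW// real_normK// num_real.
have cosk : cos (k * `|t|) = cos (k * t).
  by case: (ger0P t) => // _; rewrite mulrN cosN.
have [rt|tr'] := ltP r `|t|.
  rewrite set_itv_ge ?integral_set0// -leNgt bnd_simp subr_lt0.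
  by rewrite -(real_normK (num_real t)) ltr_pXn2r// nnegrE ltW.
move: tr'; rewrite le_eqVlt => /predU1P[tr'|tr'].
  rewrite -tr' real_normK ?num_real// subrr set_itv1 integral_set1.
  by rewrite -cosk subrr mulr0.
have rt0 : 0 < r ^+ 2 - t ^+ 2 by rewrite subr_gt0 tr.
pose F (u : R) : R := - (2 / k ^+ 2) * cos (k * Num.sqrt (t ^+ 2 + u)).
have cF : continuous F.
  move=> u; apply: cvgM; first exact: cvg_cst.
  apply: (@continuous_comp _ _ _ (fun u => k * Num.sqrt (t ^+ 2 + u)) cos u);
    last exact: continuous_cos.
  apply: cvgM; first exact: cvg_cst.
  apply: (@continuous_comp _ _ _ (fun u => t ^+ 2 + u) Num.sqrt u);
    last exact: sqrt_continuous.
  by apply: cvgD; [exact: cvg_cst|exact: cvg_id].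
have dF (u : R) : 0 < u -> is_derive u (1 : R) F (h (t ^+ 2 + u)).
  move=> u0; have tu0 : 0 < t ^+ 2 + u by rewrite ltr_wpDl// sqr_ge0.
  have d1 : is_derive u (1 : R) (fun u : R => t ^+ 2 + u) (0 + 1) by apply: is_deriveD.
  have d2 := is_derive1_comp (is_derive1_sqrt tu0) d1.
  have d3 := is_deriveZ k d2.
  have d4 := is_derive1_comp (is_derive_cos _) d3.
  have d5 : is_derive u (1 : R) F _ := is_deriveZ (- (2 / k ^+ 2)) d4.
  have s0 : Num.sqrt (t ^+ 2 + u) != 0 by rewrite gt_eqF// sqrtr_gt0.
  have k_neq0 : k != 0 by rewrite gt_eqF.
  apply: is_derive_eq d5 _; rewrite /h /sphj0 mulf_eq0 (negbTE s0) (negbTE k_neq0)/=.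
  rewrite /GRing.scale/= add0r.
  by field; rewrite s0 k_neq0.
rewrite (@continuous_FTC2 _ _ F)//.
- rewrite /F subrKC addr0 !sqrtr_sqr (ger0_norm (ltW r0)) -EFinB; congr EFin.
  by rewrite cosk; ring.
- apply: continuous_subspaceT => u.
  apply: (@continuous_comp _ _ _ (fun u => t ^+ 2 + u) h u); last exact: ch.
  by apply: cvgD; [exact: cvg_cst|exact: cvg_id].
- split.
  + by move=> u; rewrite in_itv/= => /andP[u0 _]; case: (dF _ u0).
  + exact/cvg_at_right_filter/cF.
  + exact/cvg_at_left_filter/cF.
- by move=> u; rewrite in_itv/= => /andP[u0 _]; rewrite derive1E; case: (dF _ u0).
Qed.

(** The last integration is left to a primitive G: its closed form depends on
    whether the frequency vanishes or equals k. *)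
Lemma integral_ball_sphj0 (a : Rn R 3) (G : R -> R) :
  (forall t : R, is_derive t (1 : R) G
     (cos (Num.sqrt (sqnorm a) * t) * (cos (k * t) - cos (k * r)))) ->
  \int[mu 3]_x (on_ball r (fun x => sphj0 (k * enorm x) * cos (dotp a x)) x) =
  2 * pi / k ^+ 2 * (G r - G (- r)).
Proof.
move=> dG; rewrite /Rintegral [X in fine X](integral_ball_slice r0 ch a).
set b := Num.sqrt (sqnorm a) in dG *.
pose g t := cos (b * t) * (cos (k * t) - cos (k * r)).
have cg : continuous g.
  have cc (c : R) : continuous (fun t => cos (c * t)).
    move=> u; apply: (@continuous_comp _ _ _ (fun u => c * u) cos u);
      last exact: continuous_cos.
    by apply: cvgM; [exact: cvg_cst|exact: cvg_id].
  by move=> t; apply: cvgM; [exact: cc|apply: cvgB; [exact: cc|exact: cvg_cst]].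
rewrite (_ : \int[leb]_t _ = \int[leb]_(t in `[(- r)%R, r])
  ((2 * pi / k ^+ 2)%:E * (g t)%:E))%E; last first.
  rewrite [RHS]integral_mkcond; apply: eq_integral => t _.
  rewrite integral_sphj0_sqrt patchE mem_setE in_itv/= -ler_norml.
  by case: ifPn => _; rewrite ?mule0// -!EFinM; congr EFin; rewrite /g; ring.
have mD : measurable (`[(- r)%R, r]%classic : set (measurableTypeR R)).
  exact: measurable_itv.
rewrite integralZl//; last exact: continuous_integrable_itv.
by rewrite (integral_is_derive _ cg dG)// ge0_cp// ltW.
Qed.

End ball3_spherical.

(** * Fourier coefficients of the truncated kernel *)

Section fourier_reduction.
Context (R : realType) (n : nat).
Notation leb := (@lebesgue_measure R).
Notation mu n := (lebesgue_Rn R n).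
Variables (k r c : R) (h : R -> R).
Hypotheses (r0 : 0 < r) (ch : continuous h)
  (hE : forall x : Rn R n, im_Phi k x = c * h (sqnorm x)).

Definition freq (j : n.-tuple int) : Rn R n := [tuple pi * (tnth j l)%:~R / r | l < n].

Lemma dotp_freq j (x : Rn R n) : pi * zdot j x / r = dotp (freq j) x.
Proof.
rewrite /zdot /dotp mulr_sumr mulr_suml; apply: eq_bigr => l _.
by rewrite tnth_mktuple; ring.
Qed.

Lemma sqnorm_freq j : sqnorm (freq j) = (pi * znorm R j / r) ^+ 2.
Proof.
rewrite !exprMn sqr_sqrtr; last by apply: sumr_ge0 => l _; exact: sqr_ge0.
rewrite /sqnorm mulr_sumr mulr_suml; apply: eq_bigr => l _.
by rewrite tnth_mktuple !exprMn.
Qed.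

Let integrable_kern (g : R -> R) (a : Rn R n) : continuous g -> (forall t, `|g t| <= 1) ->
  (mu n).-integrable setT (EFin \o on_ball r (fun x => h (sqnorm x) * g (dotp a x))).
Proof.
move=> cg g1; have [M hM] := continuous_itv_bounded 0 (r ^+ 2) ch.
apply: (integrable_on_ball (M := M)) => //.
  apply: measurable_funM.
    exact: (measurableT_comp (continuous_measurable_fun ch) (@measurable_sqnorm R n)).
  exact: (measurableT_comp (continuous_measurable_fun cg) (measurable_dotp a)).
move=> x xr; rewrite normrM -[M]mulr1; apply: ler_pM => //.
by apply: hM; rewrite sqnorm_ge0 ltW.
Qed.

(** Serves for the real part, with the cosine, and for the imaginary part, with the
    sine. *)
Let Rintegral_cube (f : Rn R n -> R) (e : R) (g : R -> R) (a : Rn R n) :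
  continuous g -> (forall t, `|g t| <= 1) ->
  (forall x, cube r x -> f x = truncated_kernel k r x * (e * g (dotp a x))) ->
  \int[mu n]_(x in cube r) f x =
  e * c * \int[mu n]_x (on_ball r (fun x => h (sqnorm x) * g (dotp a x)) x).
Proof.
move=> cg g1 fE; rewrite -RintegralZl//; last exact: integrable_kern.
rewrite Rintegral_mkcond; apply: eq_Rintegral => x _; rewrite patchE.
case: ifPn => [|xc].
  rewrite inE => xc; rewrite fE// truncated_kernel_cube// enorm_lt// /on_ball hE.
  by case: ifPn => _; rewrite ?mul0r ?mulr0//; ring.
rewrite /on_ball ifF ?mulr0//; apply/negP => /(ball_cube r0) h'.
by move: xc; rewrite notin_setE; apply.
Qed.

(** The imaginary part is the integral of an odd function over the ball. *)
Lemma fourier_coef_radial j :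
  fourier_coef r (fun x => (truncated_kernel k r x)%:C) j =
  ((2 * r) `^ (- n%:R / 2) * c *
   \int[mu n]_x (on_ball r (fun x => h (sqnorm x) * cos (dotp (freq j) x)) x))%:C.
Proof.
have cN t : `|cos t| <= 1 :> R by rewrite ler_norml cos_geN1 cos_le1.
have sN t : `|sin t| <= 1 :> R by rewrite ler_norml sin_geN1 sin_le1.
rewrite /fourier_coef /cintegral; congr (_ +i* _).
  apply: (Rintegral_cube (continuous_cos (R := R)) cN) => x _.
  by rewrite /phi /cexpi dotp_freq /=; ring.
rewrite (@Rintegral_cube _ (- (2 * r) `^ (- n%:R / 2)) sin (freq j)
  (continuous_sin (R := R)) sN).
  rewrite integral_odd ?mulr0//.
  - apply: measurable_on_ball; apply: measurable_funM.
      exact: (measurableT_comp (continuous_measurable_fun ch) (@measurable_sqnorm R n)).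
    exact: (measurableT_comp (continuous_measurable_fun (@continuous_sin R))
      (measurable_dotp _)).
  - move=> x; rewrite /on_ball.
    have -> : dotp (freq j) (oppt x) = - dotp (freq j) x.
      by rewrite /dotp -sumrN; apply: eq_bigr => l _; rewrite !tnth_mktuple mulrN.
    have -> : sqnorm (oppt x) = sqnorm x.
      by apply: eq_bigr => l _; rewrite tnth_mktuple sqrrN.
    by rewrite sinN mulrN; case: ifPn => _; rewrite ?oppr0.
  - exact: integrable_kern (continuous_sin (R := R)) sN.
by move=> x _; rewrite /phi /cexpi dotp_freq /=; ring.
Qed.

End fourier_reduction.

(** * The coefficients in the plane *)

Section planar.
Context (R : realType).
Notation leb := (@lebesgue_measure R).
Variables (k r : R).
Hypotheses (r0 : 0 < r) (k0 : 0 < k).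
Variable j : 2.-tuple int.
Local Notation Z := (pi * znorm R j).
Local Notation K := (fourier_coef r (fun x => (truncated_kernel k r x)%:C) j).

Let K_integral : K = (pi / (8 * r) * \int[leb]_(t in `[0, r ^+ 2])
  (besselC 0 ((k / 2) ^+ 2 * t) * besselC 0 ((Z / (2 * r)) ^+ 2 * t)))%:C.
Proof.
pose h t : R := besselC 0 ((k / 2) ^+ 2 * t).
have ch : continuous h.
  move=> t; apply: (@continuous_comp _ _ _ (fun t => (k / 2) ^+ 2 * t) (besselC 0) t);
    last exact: continuous_besselC.
  by apply: cvgM; [exact: cvg_cst|exact: cvg_id].
rewrite (@fourier_coef_radial R 2 k r 4^-1 h r0 ch).
  rewrite (integral_disk_cos _ r0 ch) sqnorm_freq; congr (_%:C).
  rewrite mulNr divff// powR_inv1 ?mulr_ge0 ?ltW// !mulrA; congr (_ * _).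
    by field; rewrite gt_eqF.
  apply: eq_Rintegral => t _; congr (_ * besselC 0 _).
  by field; rewrite gt_eqF.
move=> x; rewrite /= besselJE mul1r /h /enorm -/(sqnorm x); congr (_ * besselC 0 _).
by rewrite mulrAC exprMn sqr_sqrtr// sqnorm_ge0.
Qed.

Let scaled (c : R) : (c / (2 * r)) ^+ 2 * r ^+ 2 = (c / 2) ^+ 2.
Proof. by field; rewrite gt_eqF. Qed.

Lemma planar_coef_resonant : Z = k * r ->
  K = (pi * r / 8 * (besselJ 0 (k * r) ^+ 2 + besselJ 1 (k * r) ^+ 2))%:C.
Proof.
move=> Zkr; rewrite K_integral Zkr; congr (_%:C).
have -> : k * r / (2 * r) = k / 2 by field; rewrite gt_eqF.
have := @integral_besselC_eq R ((k / 2) ^+ 2) (r ^+ 2) (sqr_ge0 _).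
have -> : (k / 2) ^+ 2 * r ^+ 2 = (k * r / 2) ^+ 2 by field.
rewrite !besselJE expr0 mul1r expr1 => H.
have c0 : (k / 2) ^+ 2 != 0 by rewrite sqrf_eq0 mulf_neq0// gt_eqF.
apply: (mulfI c0); rewrite mulrCA H; field.
by rewrite gt_eqF.
Qed.

Lemma planar_coef_nonresonant : Z <> k * r ->
  K = (- (1 / 4) * (pi * r / (k ^+ 2 * r ^+ 2 - Z ^+ 2))
       * (Z * besselJ 0 (k * r) * besselJ 1 Z - k * r * besselJ 1 (k * r) * besselJ 0
         Z))%:C.
Proof.
move=> Zkr; rewrite K_integral; congr (_%:C).
have Z0 : 0 <= Z by rewrite mulr_ge0 ?pi_ge0 ?sqrtr_ge0.
have D0 : k ^+ 2 * r ^+ 2 - Z ^+ 2 != 0.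
  rewrite subr_eq0 -exprMn; apply/eqP => /eqP; rewrite eqrXn2// ?mulr_ge0 ?ltW//.
  by move=> /eqP /esym.
have := @integral_besselC_neq R ((k / 2) ^+ 2) ((Z / (2 * r)) ^+ 2) (r ^+ 2) (sqr_ge0 _).
have -> : (k / 2) ^+ 2 * r ^+ 2 = (k * r / 2) ^+ 2 by field.
rewrite scaled !besselJE !expr0 !mul1r !expr1 => H.
have E : (k / 2) ^+ 2 - (Z / (2 * r)) ^+ 2 = (k ^+ 2 * r ^+ 2 - Z ^+ 2) / (4 * r ^+ 2).
  by field; rewrite gt_eqF.
have c0 : (k / 2) ^+ 2 - (Z / (2 * r)) ^+ 2 != 0.
  by rewrite E mulf_neq0// invr_eq0 mulf_neq0// sqrf_eq0 gt_eqF.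
apply: (mulfI c0); rewrite mulrCA H E; move: Z D0 => z D0; field.
by rewrite exprMn D0 gt_eqF.
Qed.

End planar.

Section planar_decay.
Context (R : realType).
Variables (k r : R).
Hypotheses (r0 : 0 < r) (k0 : 0 < k).

Lemma normc_real (x : R) : Normc.normc x%:C = `|x|.
Proof. by rewrite /Normc.normc /= expr0n addr0 sqrtr_sqr. Qed.

Lemma le_mulpi (z : R) : 0 <= z -> z <= pi * z.
Proof. by move=> z0; rewrite ler_peMl// (le_trans _ (pi_ge2 R))// ler1n. Qed.

(** Once the frequency is at least twice the wave number, the denominator of the closed
    forms is comparable to its square. *)
Lemma symbol_lower_bound (Z : R) : 2 * (k * r) <= Z ->
  2^-1 * Z ^+ 2 <= `|k ^+ 2 * r ^+ 2 - Z ^+ 2|.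
Proof.
move=> kZ; have kr0 : 0 < k * r by rewrite mulr_gt0.
by rewrite -exprMn distrC ger0_norm; nra.
Qed.

Lemma powR_three_halves (z : R) : 0 < z -> z `^ (- (3 / 2)) = (z * Num.sqrt z)^-1.
Proof.
move=> z0; rewrite powRN (_ : 3 / 2 = 1 + 2^-1); last by field.
by rewrite powRD ?gt_eqF ?implybT// powRr1 ?ltW// powR12_sqrt ?ltW.
Qed.

(** The bound by Z^(-3/2), with Z = pi |j|, is passed to |j| by |j| <= Z; the
    threshold 1 + 2 k r makes [besselJ_decay] and [symbol_lower_bound] available. *)
Lemma planar_coef_bigO :
  (fun j : 2.-tuple int =>
     Normc.normc (fourier_coef r (fun x => (truncated_kernel k r x)%:C) j))
    =O_ (znorm_pinfty R 2) (fun j => znorm R j `^ (- (3 / 2))).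
Proof.
have kr0 : 0 < k * r by rewrite mulr_gt0.
have [M M0 hM] := besselJ_decay R.
set A := besselJ 0 (k * r); set B := besselJ 1 (k * r).
have pir0 : 0 <= pi * r by apply: mulr_ge0; [exact: pi_ge0|exact: ltW].
have C0 : 0 <= pi * r / 2 * (M * (`|A| + `|B|)).
  by apply: mulr_ge0; [exact: divr_ge0|apply: mulr_ge0; [exact: ltW|exact: addr_ge0]].
apply/eqO_exP; exists (pi * r / 2 * (M * (`|A| + `|B|)) + 1).
  by apply: ltr_wpDl.
suff bound (j : 2.-tuple int) : 1 + 2 * (k * r) < znorm R j ->
    `|Normc.normc (fourier_coef r (fun x => (truncated_kernel k r x)%:C) j)| <=
    (pi * r / 2 * (M * (`|A| + `|B|)) + 1) * `|znorm R j `^ (- (3 / 2))|.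
  by exists (1 + 2 * (k * r)) => // j; exact: bound.
set z := znorm R j => zj.
have z1 : 1 <= z by rewrite (le_trans _ (ltW zj))// lerDl mulr_ge0// ltW.
have z0 : 0 < z by rewrite (lt_le_trans ltr01).
have zZ := le_mulpi (ltW z0).
have Z1 : 1 <= pi * z by rewrite (le_trans z1).
have Z0 : 0 < pi * z by rewrite (lt_le_trans ltr01).
have ZK : 2 * (k * r) <= pi * z.
  by rewrite (le_trans _ zZ)// (le_trans _ (ltW zj))// lerDr.
have D := symbol_lower_bound ZK.
have Znkr : pi * z <> k * r by apply/eqP; rewrite gt_eqF//; nra.
rewrite planar_coef_nonresonant// normc_real -/z -/A -/B powR_three_halves//.
move: (pi * z) Z1 Z0 ZK D Znkr zZ => Z Z1 Z0 ZK D Znkr zZ.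
clearbody z.
have [J0Z J1Z] := hM _ Z1.
have sZ0 : 0 < Num.sqrt Z by rewrite sqrtr_gt0.
have num : `|Z * A * besselJ 1 Z - k * r * B * besselJ 0 Z| <=
    Z * (M * (`|A| + `|B|)) / Num.sqrt Z.
  apply: le_trans (ler_normB _ _) _.
  rewrite !normrM (gtr0_norm Z0) (gtr0_norm k0) (gtr0_norm r0).
  rewrite (_ : Z * _ / _ = Z * `|A| * (M / Num.sqrt Z) + Z * `|B| * (M / Num.sqrt Z));
    last by ring.
  apply: lerD; first by rewrite ler_wpM2l// mulr_ge0// ltW.
  apply: ler_pM => //; first by rewrite mulr_ge0// ltW.
  by rewrite ler_wpM2r//; nra.
have -> : `|(z * Num.sqrt z)^-1| = (z * Num.sqrt z)^-1.
  by rewrite ger0_norm// invr_ge0 mulr_ge0 ?sqrtr_ge0// ltW.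
rewrite normr_id !normrM normrN normfV (gtr0_norm (@pi_gt0 R)) (gtr0_norm r0).
rewrite [`|1 / 4|]ger0_norm ?divr_ge0//.
apply: (@le_trans _ _ (1 / 4 * (pi * r / (2^-1 * Z ^+ 2)) * (Z * (M * (`|A| + `|B|)) /
  Num.sqrt Z))).
  apply: ler_pM => //; first by apply: mulr_ge0 => //; exact: divr_ge0.
  rewrite ler_wpM2l// ler_wpM2l//.
  rewrite lef_pV2 ?posrE//.
    by apply: lt_le_trans D; rewrite mulr_gt0 ?exprn_gt0 ?invr_gt0.
  by rewrite mulr_gt0 ?exprn_gt0 ?invr_gt0.
have -> : 1 / 4 * (pi * r / (2^-1 * Z ^+ 2)) * (Z * (M * (`|A| + `|B|)) / Num.sqrt Z) =
   pi * r / 2 * (M * (`|A| + `|B|)) * (Z * Num.sqrt Z)^-1.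
  by field; rewrite !gt_eqF.
apply: ler_pM.
- exact: C0.
- by rewrite invr_ge0 mulr_ge0 ?ltW.
- by rewrite lerDl.
rewrite lef_pV2 ?posrE ?mulr_gt0 ?sqrtr_gt0//.
by apply: ler_pM => //; [exact: ltW|rewrite ler_wsqrtr].
Qed.

End planar_decay.

(** * The coefficients in space *)

Section spatial.
Context (R : realType).
Variables (k r : R).
Hypotheses (r0 : 0 < r) (k0 : 0 < k).

Section fixed_index.
Variable j : 3.-tuple int.
Local Notation Z := (pi * znorm R j).
Local Notation K := (fourier_coef r (fun x => (truncated_kernel k r x)%:C) j).

Let Z0 : 0 <= Z.
Proof. by rewrite mulr_ge0 ?pi_ge0 ?sqrtr_ge0. Qed.

Lemma spatial_coef_primitive (G : R -> R) :
  (forall t : R, is_derive t (1 : R) G (cos (Z / r * t) * (cos (k * t) - cos (k * r)))) ->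
  K = ((2 * r) `^ (- (3 / 2)) / (2 * k) * (G r - G (- r)))%:C.
Proof.
move=> dG; have ch : continuous (fun t => sphj0 (k * Num.sqrt t)).
  move=> t; apply: (@continuous_comp _ _ _ (fun u => k * Num.sqrt u) (@sphj0 R) t).
    by apply: cvgM; [exact: cvg_cst|exact: sqrt_continuous].
  exact: continuous_sphj0.
rewrite (@fourier_coef_radial R 3 k r (k / (4 * pi)) _ r0 ch)//.
have E : Num.sqrt (sqnorm (freq r j)) = Z / r.
  by rewrite sqnorm_freq sqrtr_sqr ger0_norm// divr_ge0// ltW.
rewrite -E in dG; rewrite (integral_ball_sphj0 k0 r0 dG).
rewrite mulNr; congr (_%:C); have := pi_gt0 R; move: (pi : R) => p p0; field.
by rewrite (gt_eqF k0) (gt_eqF p0).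
Qed.

Let dsin (c t : R) : is_derive t (1 : R) (fun t => sin (c * t)) (c * cos (c * t)).
Proof.
have h := is_derive1_comp (is_derive_sin (c * t)) (is_derive_mull c t).
by apply: is_derive_eq h _; rewrite mulrC.
Qed.

Let dcos (c t : R) : is_derive t (1 : R) (fun t => cos (c * t)) (- (c * sin (c * t))).
Proof.
have h := is_derive1_comp (is_derive_cos (c * t)) (is_derive_mull c t).
by apply: is_derive_eq h _; rewrite mulNr mulrC.
Qed.

Lemma spatial_coef_resonant : Z = k * r ->
  K = ((2 * r) `^ (- (3 / 2)) * (r ^+ 2 / 2)
        * (k * r * (sphj0 (k * r) ^+ 2 + sphj1 (k * r) ^+ 2)
           - sphj0 (k * r) * sphj1 (k * r)))%:C.
Proof.
move=> Zkr; have kn0 : k != 0 by rewrite gt_eqF.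
have rn0 : r != 0 by rewrite gt_eqF.
pose G (t : R) := 2^-1 * t + (2^-1 / k) * (sin (k * t) * cos (k * t)) -
  (cos (k * r) / k) * sin (k * t).
have dG t : is_derive t (1 : R) G (cos (Z / r * t) * (cos (k * t) - cos (k * r))).
  rewrite Zkr mulfK//.
  have h : is_derive t (1 : R) G _ := is_deriveB (is_deriveD (is_derive_mull 2^-1 t)
    (is_deriveZ (2^-1 / k) (is_deriveM (dsin k t) (dcos k t))))
    (is_deriveZ (cos (k * r) / k) (dsin k t)).
  apply: is_derive_eq h _; rewrite ?fctE /= /GRing.scale/=.
  have := cos2Dsin2 (k * t); move: (cos (k * r)) (cos (k * t)) (sin (k * t)) => D C S CS.
  transitivity (2^-1 + 2^-1 * (C ^+ 2 - S ^+ 2) - D * C); first by field.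
  have -> : S ^+ 2 = 1 - C ^+ 2 by rewrite -CS addrAC subrr add0r.
  by field.
rewrite (spatial_coef_primitive dG).
congr (_%:C); rewrite /G !mulrN sinN cosN /sphj0 /sphj1.
rewrite mulf_eq0 (negbTE kn0) (negbTE rn0) /=.
have := cos2Dsin2 (k * r).
move: (cos (k * r)) (sin (k * r)) => C S CS.
have C2 : C ^+ 2 = 1 - S ^+ 2 by rewrite -CS addrK.
rewrite -!mulrA; congr (_ * _).
transitivity (r / (2 * k) - S * C / (2 * k ^+ 2)); first by field.
transitivity (r ^+ 2 / 2 * (k * r * (S ^+ 2 / (k * r) ^+ 2 + (S ^+ 2 / (k * r) ^+ 4
   - 2 * S * C / (k * r) ^+ 3 + C ^+ 2 / (k * r) ^+ 2)) - S / (k * r) * (S / (k * r) ^+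
     2 - C / (k * r)))).
  by rewrite C2; field; rewrite kn0 rn0.
by field; rewrite kn0 rn0.
Qed.

Lemma spatial_coef_nonresonant : Z <> k * r -> znorm R j <> 0 ->
  K = (k * r * (2 * r) `^ (- (3 / 2))
      * (r ^+ 2 / (k ^+ 2 * r ^+ 2 - Z ^+ 2))
      * (k * r * sphj0 Z * sphj1 (k * r) - Z * sphj0 (k * r) * sphj1 Z))%:C.
Proof.
move=> Zkr /eqP z0; have kn0 : k != 0 by rewrite gt_eqF.
have rn0 : r != 0 by rewrite gt_eqF.
have D0 : k ^+ 2 * r ^+ 2 - Z ^+ 2 != 0.
  rewrite subr_eq0 -exprMn; apply/eqP => /eqP; rewrite eqrXn2// ?mulr_ge0 ?ltW//.
  by move=> /eqP /esym.
have Zn0 : Z != 0 by rewrite mulf_neq0// gt_eqF// pi_gt0.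
pose b := Z / r; have bn0 : b != 0 by rewrite mulf_neq0// invr_eq0.
have ZE : Z = b * r by rewrite /b divfK.
have E0 : k ^+ 2 - b ^+ 2 != 0.
  have : (k ^+ 2 - b ^+ 2) * r ^+ 2 != 0 by rewrite mulrBl -[b ^+ 2 * _]exprMn -ZE.
  by rewrite mulf_eq0 negb_or => /andP[].
pose G (t : R) := (k ^+ 2 - b ^+ 2)^-1 * (k * (sin (k * t) * cos (b * t)) - b * (cos (k
  * t) * sin (b * t)))
  - (cos (k * r) / b) * sin (b * t).
have dG t : is_derive t (1 : R) G (cos (Z / r * t) * (cos (k * t) - cos (k * r))).
  rewrite -/b.
  have h : is_derive t (1 : R) G _ := is_deriveB (is_deriveZ (k ^+ 2 - b ^+ 2)^-1
    (is_deriveB (is_deriveZ k (is_deriveM (dsin k t) (dcos b t)))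
      (is_deriveZ b (is_deriveM (dcos k t) (dsin b t)))))
    (is_deriveZ (cos (k * r) / b) (dsin b t)).
  apply: is_derive_eq h _; rewrite ?fctE /= /GRing.scale/=.
  move: (cos (k * r)) (sin (k * t)) (cos (k * t)) (cos (b * t)) (sin (b * t)) =>
    D S C C' S'.
  by field; rewrite bn0 E0.
rewrite (spatial_coef_primitive dG).
congr (_%:C); rewrite /G !mulrN !sinN !cosN /sphj0 /sphj1.
rewrite (negbTE Zn0) mulf_eq0 (negbTE kn0) (negbTE rn0) /=.
have -> : k ^+ 2 * r ^+ 2 - Z ^+ 2 = (k ^+ 2 - b ^+ 2) * r ^+ 2 by rewrite ZE; ring.
rewrite ZE; move: (cos (k * r)) (sin (k * r)) (cos (b * r)) (sin (b * r)) => C S C' S'.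
by field; rewrite kn0 rn0 bn0 E0.
Qed.

Lemma spatial_coef0 : znorm R j = 0 ->
  K = (1 / k * (2 * r) `^ (- (3 / 2)) * (1 / k * sin (k * r) - r * cos (k * r)))%:C.
Proof.
move=> z0; have kn0 : k != 0 by rewrite gt_eqF.
pose G (t : R) := k^-1 * sin (k * t) - cos (k * r) * t.
have dG t : is_derive t (1 : R) G (cos (Z / r * t) * (cos (k * t) - cos (k * r))).
  rewrite z0 mulr0 mul0r mul0r cos0 mul1r.
  have h : is_derive t (1 : R) G _ :=
    is_deriveB (is_deriveZ k^-1 (dsin k t)) (is_derive_mull (cos (k * r)) t).
  by apply: is_derive_eq h _; rewrite ?fctE /= /GRing.scale/=; field.
rewrite (spatial_coef_primitive dG).
by congr (_%:C); rewrite /G !mulrN sinN; field.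
Qed.

End fixed_index.

(** Here |j_0(Z)| <= 1 and |Z j_1(Z)| <= 2 for Z >= 1, so the bracket of the closed
    form is bounded and the denominator alone gives the rate. *)
Lemma spatial_coef_bigO :
  (fun j : 3.-tuple int =>
     Normc.normc (fourier_coef r (fun x => (truncated_kernel k r x)%:C) j))
    =O_ (znorm_pinfty R 3) (fun j => znorm R j `^ (- 2)).
Proof.
have kr0 : 0 < k * r by rewrite mulr_gt0.
set A := sphj0 (k * r); set B := sphj1 (k * r); set w := (2 * r) `^ (- (3 / 2)).
have w0 : 0 <= w by exact: powR_ge0.
pose C := k * r * w * (2 * r ^+ 2) * (k * r * `|B| + 2 * `|A|).
have C0 : 0 <= C.
  by rewrite !mulr_ge0 ?addr_ge0 ?mulr_ge0 ?sqr_ge0 ?(ltW k0) ?(ltW r0).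
apply/eqO_exP; exists (C + 1); first by apply: ltr_wpDl.
suff bound (j : 3.-tuple int) : 1 + 2 * (k * r) < znorm R j ->
    `|Normc.normc (fourier_coef r (fun x => (truncated_kernel k r x)%:C) j)| <=
    (C + 1) * `|znorm R j `^ (- 2)|.
  by exists (1 + 2 * (k * r)) => // j; exact: bound.
set z := znorm R j => zj.
have z1 : 1 <= z by rewrite (le_trans _ (ltW zj))// lerDl mulr_ge0// ltW.
have z0 : 0 < z by rewrite (lt_le_trans ltr01).
have zZ := le_mulpi (ltW z0).
have Z1 : 1 <= pi * z by rewrite (le_trans z1).
have Z0 : 0 < pi * z by rewrite (lt_le_trans ltr01).
have ZK : 2 * (k * r) <= pi * z.
  by rewrite (le_trans _ zZ)// (le_trans _ (ltW zj))// lerDr.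
have D := symbol_lower_bound r0 k0 ZK.
have Znkr : pi * z <> k * r by apply/eqP; rewrite gt_eqF//; nra.
have zn0 : z <> 0 by apply/eqP; rewrite gt_eqF.
rewrite spatial_coef_nonresonant// normc_real -/z -/A -/B -/w.
rewrite [z `^ _]powR_invn ?(ltW z0)//.
move: (pi * z) Z1 Z0 ZK D Znkr zZ => Z Z1 Z0 ZK D Znkr zZ.
clearbody z.
have j0Z : `|sphj0 Z| <= 1.
  rewrite /sphj0 gt_eqF// normrM normfV (gtr0_norm Z0) ler_pdivrMr// mul1r.
  by apply: le_trans Z1; rewrite ler_norml sin_geN1 sin_le1.
have j1Z : `|Z * sphj1 Z| <= 2.
  rewrite /sphj1 gt_eqF// (_ : Z * _ = sin Z / Z - cos Z); last by field; rewrite gt_eqF.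
  apply: le_trans (ler_normB _ _) _; rewrite -[2]/(1 + 1); apply: lerD.
    by move: j0Z; rewrite /sphj0 gt_eqF.
  by rewrite ler_norml cos_geN1 cos_le1.
have num : `|k * r * sphj0 Z * B - Z * A * sphj1 Z| <= k * r * `|B| + 2 * `|A|.
  apply: le_trans (ler_normB _ _) _; apply: lerD.
    rewrite !normrM (gtr0_norm k0) (gtr0_norm r0) ler_wpM2r// -[leRHS]mulr1.
    by rewrite ler_wpM2l// ltW.
  by rewrite mulrAC normrM ler_wpM2r.
have -> : `|z ^- 2| = z ^- 2 by rewrite ger0_norm// invr_ge0 sqr_ge0.
rewrite normr_id 2!normrM [`|k * r * w|]ger0_norm; last by rewrite mulr_ge0 ?(ltW kr0).
rewrite normrM normfV [`|r ^+ 2|]ger0_norm ?sqr_ge0//.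
apply: (@le_trans _ _ (k * r * w * (r ^+ 2 / (2^-1 * Z ^+ 2)) * (k * r * `|B| + 2 *
  `|A|))).
  apply: ler_pM => //.
    by rewrite !mulr_ge0 ?invr_ge0 ?sqr_ge0 ?(ltW k0) ?(ltW r0).
  apply: ler_wpM2l; first by apply: mulr_ge0 => //; exact: ltW.
  apply: ler_wpM2l; first exact: sqr_ge0.
  rewrite lef_pV2 ?posrE//.
    by apply: lt_le_trans D; rewrite mulr_gt0 ?exprn_gt0 ?invr_gt0.
  by rewrite mulr_gt0 ?exprn_gt0 ?invr_gt0.
have -> : k * r * w * (r ^+ 2 / (2^-1 * Z ^+ 2)) * (k * r * `|B| + 2 * `|A|) = C * Z ^- 2.
  by rewrite /C; field; rewrite gt_eqF.
apply: ler_pM => //.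
- by rewrite invr_ge0 sqr_ge0.
- by rewrite lerDl.
rewrite lef_pV2 ?posrE ?exprn_gt0//.
by rewrite lerXn2r// nnegrE ltW.
Qed.

End spatial.

Theorem theorem3p1 (R : realType) (n : nat) (rho r k : R)
    (hn : n = 2%N \/ n = 3%N) (hrho : 0 < rho) (hr : 2 * rho <= r)
    (hk : 0 < k) :
  let Khat : n.-tuple int -> R[i] :=
    fourier_coef r (fun x => (truncated_kernel k r x)%:C) in
  (n = 2%N ->
     (forall j : n.-tuple int, pi * znorm R j = k * r ->
        Khat j = (pi * r / 8
          * (besselJ 0 (k * r) ^+ 2 + besselJ 1 (k * r) ^+ 2))%:C)
  /\ (forall j : n.-tuple int, pi * znorm R j <> k * r ->
        Khat j = (- (1 / 4)
          * (pi * r / (k ^+ 2 * r ^+ 2 - pi ^+ 2 * znorm R j ^+ 2))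
          * (pi * znorm R j * besselJ 0 (k * r) * besselJ 1 (pi * znorm R j)
             - k * r * besselJ 1 (k * r) * besselJ 0 (pi * znorm R j)))%:C)
  /\ (fun j => Normc.normc (Khat j)) =O_ (znorm_pinfty R n)
       (fun j => znorm R j `^ (- (3 / 2))))
  /\
  (n = 3%N ->
     (forall j : n.-tuple int, pi * znorm R j = k * r ->
        Khat j = ((2 * r) `^ (- (3 / 2)) * (r ^+ 2 / 2)
          * (k * r * (sphj0 (k * r) ^+ 2 + sphj1 (k * r) ^+ 2)
             - sphj0 (k * r) * sphj1 (k * r)))%:C)
  /\ (forall j : n.-tuple int, pi * znorm R j <> k * r -> znorm R j <> 0 ->
        Khat j = (k * r * (2 * r) `^ (- (3 / 2))
          * (r ^+ 2 / (k ^+ 2 * r ^+ 2 - pi ^+ 2 * znorm R j ^+ 2))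
          * (k * r * sphj0 (pi * znorm R j) * sphj1 (k * r)
             - pi * znorm R j * sphj0 (k * r) * sphj1 (pi * znorm R j)))%:C)
  /\ (forall j : n.-tuple int, znorm R j = 0 ->
        Khat j = (1 / k * (2 * r) `^ (- (3 / 2))
          * (1 / k * sin (k * r) - r * cos (k * r)))%:C)
  /\ (fun j => Normc.normc (Khat j)) =O_ (znorm_pinfty R n)
       (fun j => znorm R j `^ (- 2))).
Proof.
have r0 : 0 < r by rewrite (lt_le_trans _ hr)// mulr_gt0.
split=> n_eq; subst n.
  split; first by move=> j; exact: planar_coef_resonant.
  split; last exact: planar_coef_bigO.
  by move=> j Zkr; rewrite planar_coef_nonresonant// exprMn.
split; first by move=> j; exact: spatial_coef_resonant.
split.
  by move=> j Zkr z0; rewrite spatial_coef_nonresonant// exprMn.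
split; last exact: spatial_coef_bigO.
by move=> j; exact: spatial_coef0.
Qed.
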